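(* For any $\varepsilon\in(0,1]$, $$\sum_{\tau\in T_0^*}\frac1{S(\tau)}\Pi^R_{\varepsilon,0}\tau=\sum_{\sigma\in T_0^{X,-,*}}\frac{\ell(\sigma)}{S(\sigma)}\Upsilon[\sigma],$$ so that $\phi_{\varepsilon,0}$ solves the SPDE $$L\phi=g(\phi,\dots,\nabla^q\phi)+f(\phi,\dots,\nabla^p\phi)\,\xi_\varepsilon+\sum_{\sigma\in T_0^{X,-,*}\setminus\{\mathbf 1,\Xi\}}\frac{\ell(\sigma)}{S(\sigma)}\Upsilon[\sigma][\phi].$$
   Context: **Trees.** Fix $d\ge1$; $0\in\mathbb N$. A decorated tree is a finite non-planar rooted tree. In this statement node marks $\mathfrak v\in\{0,1\}$ are all set to $1$ and omitted. Each node carries a polynomial decoration $X^k$, $k\in\mathbb N^{d+1}$ ($X^0=\mathbf 1$). Each edge is of one of the types $\mathcal I_a$, grey $\bar{\mathcal I}_a$ ($a\in\mathbb N^{d+1}$), noise $\Xi$, grey noise $\bar\Xi$. At most one noise-type edge leaves a node; grey edges $\bar{\mathcal I}_a$ are terminal with top node decorated by some $X^k$, written $\bar{\mathcal I}_a(X^k)$. The product of trees identifies the roots and adds polynomial decorations. $\mathcal I_a(\tau)$ attaches the root of $\tau$ to a new root by an edge $\mathcal I_a$. Put $\zeta_0=\mathbf 1$, $\zeta_1=\Xi$. A tree is $\zeta_lX^k\prod_i\mathcal I_{a_i}(\tau_i)\prod_q\bar{\mathcal I}_{c_q}(X^{k_q})$ (empty products allowed), possibly with a factor $\bar\Xi$.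 Standing convention: $\mathcal I_a(\mathbf 1)=0$, and $\mathcal I_a(\tau)=0$ if $\tau$ is composed only of grey symbols or contains at least one $\bar\Xi$. $T_0^*$: trees with only $\mathcal I$ and $\Xi$ edges and no polynomials. $T_0^{X,*}$: same with polynomial decorations allowed; $\mathcal T_0^X$ is the span of such trees. $T_0^{X,-,*}$: trees of $T_0^{X,*}$ of non-positive degree. Infinite sums over multi-indices are formal (in practice finite). Symmetry factor: $S(\zeta_l)=1$, $S\big(X^k\zeta_l\prod_i\mathcal I_{a_i}(\tau_i)^{\beta_i}\big)=k!\prod_iS(\tau_i)^{\beta_i}\beta_i!$ with the $(a_i,\tau_i)$ pairwise distinct. **Degree.** Parabolic scaling $|k|_{\mathfrak s}=2k_1+\sum_{i\ge2}k_i$; fixed $\alpha\in(0,1]$, small $\kappa>0$. $\deg\Xi=-2+\alpha-\kappa$, $\deg X^k=|k|_{\mathfrak s}$, $\deg(\sigma\tau)=\deg\sigma+\deg\tau$, $\deg\mathcal I_a(\tau)=\deg\tau+2-|a|_{\mathfrak s}$, grey edges have degree $0$. **Root extraction.** $\Delta_r$ is multiplicative with $\Delta_r\mathbf 1=\mathbf 1\otimes\mathbf 1$, $\Delta_r\Xi=\bar\Xi\otimes\Xi+\Xi\otimes\mathbf 1$, $\Delta_r\mathcal I_a(\tau)=(\mathcal I_a\otimes\mathrm{id})\Delta_r\tau+\sum_{k\in\mathbb N^{d+1}}\frac1{k!}\bar{\mathcal I}_a(X^k)\otimes\mathcal I_{a+k}(\tau)$. **Localisation.** $M_{\rm loc}\big(\zeta_l\prod_i\mathcal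 I_{a_i}(\tau_i)\big)=\sum_{k\in\mathbb N^{d+1}}\frac{X^k}{k!}\zeta_l\prod_i\mathcal I_{a_i}(M_{\rm loc}\tau_i)$; factors $\bar\Xi$ and $\bar{\mathcal I}_b(X^j)$ are left untouched. **Elementary differentials.** Consider the equation $L\psi=g(\psi,\dots,\nabla^q\psi)+f(\psi,\dots,\nabla^p\psi)\xi$, $L=\partial_t-\Delta$, $p,q<2$, assumed subcritical, with $g,f$ smooth. Put $\Upsilon^0=g$, $\Upsilon^1=f$, seen as functions of variables $(Z_a)_{a\in\mathbb N^{d+1}}$ representing $\partial^a\phi$. $D_a=\partial_{Z_a}$; $\partial^{e_i}=\sum_aZ_{a+e_i}D_a$ ($e_i$ the canonical basis of $\mathbb N^{d+1}$), $\partial^k=\prod_i(\partial^{e_i})^{k_i}$. $\Upsilon[\zeta_l]=\Upsilon^l$ and $\Upsilon\big[X^k\zeta_l\prod_{i=1}^n\mathcal I_{a_i}(\tau_i)\prod_{j=1}^m\bar{\mathcal I}_{b_j}(X^{k_j})\big]=(\partial^kD_{a_1}\cdots D_{a_n}D_{b_1}\cdots D_{b_m}\Upsilon^l)\prod_i\Upsilon[\tau_i]$; if $\bar\Xi$ is present at a node, $\Upsilon^1$ is used there. The map $\downarrow$ removes $\bar\Xi$, and removes each $\bar{\mathcal I}_b(X^j)$ while multiplying its base node by $X^j$. $\ell:\mathcal T_0^X\to\mathbb R$ is a character with $\ell(\mathbf 1)=1$, vanishing on all other trees of non-negative degree. $\ell\Upsilon[\tau]:=\ell(\downarrow\tau)\Upsilon[\tau]$.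 **Evaluation.** $G$ is the Green kernel of $L$ on $[0,1]\times\mathbb T^d$, $G_\mu(t,x)=\chi(t/\mu^2)G(t,x)$, $G_0=G$, with $\chi$ smooth non-decreasing, $\chi=0$ on $[0,1]$, $\chi=1$ on $[2,\infty)$; $\xi_\varepsilon$ is the mollified noise. As functionals of $\phi$: $\Pi^{R\times}_{\varepsilon,\mu}\mathbf 1=1$, $\Pi^{R\times}_{\varepsilon,\mu}\Xi=\xi_\varepsilon$, $\Pi^{R\times}_{\varepsilon,\mu}$ multiplicative, $\Pi^{R\times}_{\varepsilon,\mu}\mathcal I_a(\tau)=\partial^a(G-G_\mu)*\Pi^R_{\varepsilon,\mu}\tau$, $\Pi^R_{\varepsilon,\mu}\tau=(\ell\Upsilon\otimes\Pi^{R\times}_{\varepsilon,\mu})(M_{\rm loc}\otimes\mathrm{id})\Delta_r\tau$. **The function $\phi_{\varepsilon,0}$** is the coarse-grained process at scale $\mu=0$: it solves $\phi_{\varepsilon,0}=G*F_{\varepsilon,0}[\phi_{\varepsilon,0}]$ with $F_{\varepsilon,0}[\phi]=\sum_{\tau\in T_0^*}\frac1{S(\tau)}(\Pi^R_{\varepsilon,0}\tau)[\phi]$ (the treatment of the initial condition is suppressed from the notation).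
   Formalization: In the first display the term σ=Ξ is read as f ξ_ε instead of ℓ(Ξ) f, and ℓ(Ξ)=0 is assumed; literally, the first display would lack f ξ_ε (e.g. g=0, f=1) and the second would lack ℓ(Ξ) f. *)

(* Defs.v *)
From HB Require Import structures.
From mathcomp Require Import all_boot all_order all_algebra.
From mathcomp Require Import all_classical all_reals all_analysis.

Set Implicit Arguments.
Unset Strict Implicit.
Unset Printing Implicit Defensive.
Import Order.TTheory GRing.Theory Num.Theory.
Import numFieldNormedType.Exports.
Local Open Scope classical_set_scope.
Local Open Scope ring_scope.

(* Multi-indices in N^(d+1).  The coordinate [ord0] is time. *)
Definition mi (d : nat) := {ffun 'I_d.+1 -> nat}.

Section multi_index.
Variable d : nat.

Definition mi0 : mi d := [ffun=> 0%N].
Definition mi_add (a b : mi d) : mi d := [ffun i => (a i + b i)%N].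
Definition mi_unit (i : 'I_d.+1) : mi d := [ffun j => nat_of_bool (j == i)].
Definition mi_fact (k : mi d) : nat := (\prod_i (k i)`!)%N.
Definition sdeg (k : mi d) : nat :=
  (\sum_i (if i == ord0 then 2 else 1) * k i)%N.

(* [iter_dir op k] is the composition of the [k i]-th iterates of [op i]. *)
Definition iter_dir (V : Type) (op : 'I_d.+1 -> V -> V) (k : mi d) (F : V) : V :=
  foldr (fun i F' => iter (k i) (op i) F') F (enum 'I_d.+1).

End multi_index.

Inductive noise := NoNoise | Xi | XiBar.

HB.instance Definition _ := gen_eqMixin noise.
HB.instance Definition _ := gen_choiceMixin noise.

(* A planar representative: [Node k n gs bs] is the tree whose root carries the
   decoration X^k and the noise-type edge [n], with one grey edge Ibar_a(X^j)
   for each (a, j) in [gs] and one branch I_a(t) for each (a, t) in [bs]. *)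
Inductive ptree (d : nat) :=
  Node of mi d & noise & seq (mi d * mi d) & seq (mi d * ptree d).

HB.instance Definition _ d := gen_eqMixin (ptree d).
HB.instance Definition _ d := gen_choiceMixin (ptree d).

Inductive tree_iso (d : nat) : ptree d -> ptree d -> Prop :=
| iso_refl t : tree_iso t t
| iso_sym t u : tree_iso t u -> tree_iso u t
| iso_trans t u v : tree_iso t u -> tree_iso u v -> tree_iso t v
| iso_perm k n gs gs' bs bs' : perm_eq gs gs' -> perm_eq bs bs' ->
    tree_iso (Node k n gs bs) (Node k n gs' bs')
| iso_branch k n gs a t u bs : tree_iso t u ->
    tree_iso (Node k n gs ((a, t) :: bs)) (Node k n gs ((a, u) :: bs)).

Section tree_quotient.
Variable d : nat.

Definition tree_isob (t u : ptree d) : bool := `[< tree_iso t u >].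

Lemma tree_isob_refl : reflexive tree_isob.
Proof. by move=> t; apply/asboolP; exact: iso_refl. Qed.

Lemma tree_isob_sym : symmetric tree_isob.
Proof. by move=> t u; apply/asboolP/asboolP; exact: iso_sym. Qed.

Lemma tree_isob_trans : transitive tree_isob.
Proof.
move=> t u v /asboolP ut /asboolP tv; apply/asboolP; exact: iso_trans ut tv.
Qed.

Canonical tree_equiv :=
  EquivRel tree_isob tree_isob_refl tree_isob_sym tree_isob_trans.

Definition tree := {eq_quot tree_equiv}%qT.

HB.instance Definition _ := Choice.on tree.
HB.instance Definition _ := EqQuotient.on tree.

End tree_quotient.

(* Maps on trees are given on planar representatives and are compatible with
   [tree_iso]. *)
Section planar_operations.
Variable d : nat.
Implicit Types (t u : ptree d) (a k : mi d).

Definition pone : ptree d := Node (mi0 d) NoNoise [::] [::].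
Definition pXi : ptree d := Node (mi0 d) Xi [::] [::].
Definition pX k : ptree d := Node k NoNoise [::] [::].
Definition pI a t : ptree d := Node (mi0 d) NoNoise [::] [:: (a, t)].
Definition pIbar a k : ptree d := Node (mi0 d) NoNoise [:: (a, k)] [::].

(* At most one noise-type edge leaves a node, so that [noise_mul] is only used
   with at least one argument equal to [NoNoise]. *)
Definition noise_mul (n m : noise) : noise := if n is NoNoise then m else n.

Definition pmul t u : ptree d :=
  let: Node k n gs bs := t in let: Node k' n' gs' bs' := u in
  Node (mi_add k k') (noise_mul n n') (gs ++ gs') (bs ++ bs').

Definition pmul2 (p q : ptree d * ptree d) : ptree d * ptree d :=
  (pmul p.1 q.1, pmul p.2 q.2).

Definition pnoise t : noise := let: Node _ n _ _ := t in n.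
Definition pbranches t : seq (mi d * ptree d) := let: Node _ _ _ bs := t in bs.

Fixpoint has_XiBar t : bool :=
  let: Node _ n _ bs := t in
  (n == XiBar) || has (fun b => has_XiBar b.2) bs.

(* The tree 1 is the empty product of grey symbols. *)
Definition only_grey t : bool :=
  let: Node k n gs bs := t in [&& k == mi0 d, n != Xi & nilp bs].

(* I_a(t) = 0 unless t is plantable. *)
Definition plantable t : bool := ~~ only_grey t && ~~ has_XiBar t.

Fixpoint height t : nat :=
  let: Node _ _ _ bs := t in foldr (fun b h => maxn (height b.2).+1 h) 0%N bs.

Fixpoint down t : ptree d :=
  let: Node k n gs bs := t in
  Node (foldr (fun b j => mi_add b.2 j) k gs)
       (if n is XiBar then NoNoise else n) [::]
       [seq (b.1, down b.2) | b <- bs].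

(* Trees with edges I and Xi only; I_a(1) = 0 is not a tree. *)
Fixpoint in_TX t : bool :=
  let: Node k n gs bs := t in
  [&& n != XiBar, nilp gs & all (fun b => (b.2 != pone) && in_TX b.2) bs].

Fixpoint no_poly t : bool :=
  let: Node k _ _ bs := t in (k == mi0 d) && all (fun b => no_poly b.2) bs.

(* With the pairs (a_i, tau_i) listed with multiplicity, the product of the
   S(tau_i)^beta_i is the product of S over the list, and the factors beta_i!
   run over the distinct classes. *)
Fixpoint psym t : nat :=
  let: Node k _ _ bs := t in
  (mi_fact k * foldr (fun b m => psym b.2 * m) 1 bs *
   let cls := [seq (b.1, \pi_(tree d)%qT b.2) | b <- bs] in
   \prod_(c <- undup cls) (count_mem c cls)`!)%N.

Fixpoint pdeg (R : realType) (alpha kappa : R) t : R :=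
  let: Node k n _ bs := t in
  (if n is Xi then -2 + alpha - kappa else 0) + (sdeg k)%:R +
  foldr (fun b x => (pdeg alpha kappa b.2 + 2 - (sdeg b.1)%:R) + x) 0 bs.

End planar_operations.

Section trees.
Variable d : nat.

Definition tone : tree d := \pi_(tree d)%qT (pone d).
Definition tXi : tree d := \pi_(tree d)%qT (pXi d).

Definition treesX : set (tree d) := [set s | in_TX (repr s)].
Definition trees0 : set (tree d) := [set s | in_TX (repr s) && no_poly (repr s)].

Definition symf (s : tree d) : nat := psym (repr s).

Definition deg (R : realType) (alpha kappa : R) (s : tree d) : R :=
  pdeg alpha kappa (repr s).

Definition treesX_nonpos (R : realType) (alpha kappa : R) : set (tree d) :=
  [set s | treesX s /\ deg alpha kappa s <= 0].

End trees.
Arguments tone {d}.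
Arguments tXi {d}.
Arguments trees0 {d}.
Arguments treesX {d}.

(* A formal, possibly infinite, linear combination of elements of T is the
   function giving its coefficients. *)
Section series.
Variable R : realType.

Definition monomial (T : choiceType) (t : T) : T -> R := fun u => (u == t)%:R.

Definition series_mul (T : choiceType) (m : T -> T -> T) (s1 s2 : T -> R) : T -> R :=
  fun u => \sum_(p \in [set p : T * T | m p.1 p.2 = u]) s1 p.1 * s2 p.2.

(* Linear extension of the map equal to [h] on [A] and to 0 off [A]. *)
Definition series_map (T U : choiceType) (A : set T) (h : T -> U) (s : T -> R) : U -> R :=
  fun u => \sum_(t \in [set t | A t /\ h t = u]) s t.

Variable d : nat.
Implicit Types (t : ptree d) (a : mi d).

Definition Delta_noise (k : mi d) (n : noise) (gs : seq (mi d * mi d)) :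
    ptree d * ptree d -> R :=
  if n is Xi
  then fun p => monomial (Node k XiBar gs [::], pXi d) p
                + monomial (Node k Xi gs [::], pone d) p
  else monomial (Node k n gs [::], pone d).

Definition Delta_branch a t (Dt : ptree d * ptree d -> R) :
    ptree d * ptree d -> R :=
  fun p =>
    series_map [set p' | plantable p'.1] (fun p' => (pI a p'.1, p'.2)) Dt p
    + \sum_(k \in [set: mi d])
        (mi_fact k)%:R^-1 * (plantable t)%:R
        * monomial (pIbar a k, pI (mi_add a k) t) p.

Fixpoint Delta t : ptree d * ptree d -> R :=
  let: Node k n gs bs := t in
  series_mul (@pmul2 d) (Delta_noise k n gs)
    (foldr (fun b s =>
       series_mul (@pmul2 d) (Delta_branch b.1 b.2 (Delta b.2)) s)
       (monomial (pone d, pone d)) bs).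

Fixpoint Mloc t : ptree d -> R :=
  let: Node j n gs bs := t in
  series_mul (@pmul d)
    (fun u => \sum_(k \in [set: mi d]) (mi_fact k)%:R^-1 * monomial (pX k) u)
    (foldr (fun b s =>
       series_mul (@pmul d) (series_map [set u | plantable u] (pI b.1) (Mloc b.2)) s)
       (monomial (Node j n gs [::])) bs).

Definition Mloc_Delta t : ptree d * ptree d -> R :=
  fun p => \sum_(s \in [set: ptree d]) Delta t (s, p.2) * Mloc s p.1.

End series.

Section jets.
Variables (R : realType) (d : nat).

Definition jetfun := (mi d -> R) -> R.

Definition jet_shift (Z : mi d -> R) (a : mi d) (h : R) : mi d -> R :=
  fun b => Z b + h * (b == a)%:R.

Definition DZ (a : mi d) (F : jetfun) : jetfun :=
  fun Z => derive1 (fun h : R => F (jet_shift Z a h)) 0.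

Definition Ds (s : seq (mi d)) (F : jetfun) : jetfun := foldr DZ F s.

Definition jet_continuous (F : jetfun) : Prop :=
  forall (Z : mi d -> R) (e : R), 0 < e ->
    exists (s : seq (mi d)) (r : R), 0 < r /\
      forall Z' : mi d -> R, (forall a, a \in s -> `|Z' a - Z a| < r) ->
        `|F Z' - F Z| < e.

Definition jet_smooth (F : jetfun) : Prop :=
  forall s : seq (mi d), jet_continuous (Ds s F) /\
    forall (Z : mi d -> R) (a : mi d),
      derivable (fun h : R => Ds s F (jet_shift Z a h)) 0 1.

(* F is a function of (psi, ..., nabla^n psi), nabla being the space gradient. *)
Definition depends_upto (n : nat) (F : jetfun) : Prop :=
  forall Z Z' : mi d -> R,
    (forall a : mi d, a ord0 = 0%N -> (sdeg a <= n)%N -> Z a = Z' a) -> F Z = F Z'.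

Definition dZ (i : 'I_d.+1) (F : jetfun) : jetfun :=
  fun Z => \sum_(a \in [set: mi d]) Z (mi_add a (mi_unit i)) * DZ a F Z.

Definition Ups0 (g f : jetfun) (n : noise) : jetfun :=
  if n is NoNoise then g else f.

Fixpoint pUps (g f : jetfun) (t : ptree d) : jetfun :=
  let: Node k n gs bs := t in
  fun Z => iter_dir dZ k (Ds (map fst bs) (Ds (map fst gs) (Ups0 g f n))) Z
           * foldr (fun b x => pUps g f b.2 Z * x) 1 bs.

Definition Ups (g f : jetfun) (s : tree d) : jetfun := pUps g f (repr s).

(* Subcriticality of the rule of the equation in the sense of Bruned, Hairer
   and Zambotti: a node with outgoing edges I_(a_1), ..., I_(a_n), and possibly
   Xi, is allowed when D_(a_1)...D_(a_n) of g (resp. f) does not vanish.  The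
   equation is subcritical if one can assign regularities regXi < deg Xi and
   regI to the noise and to the solution such that
   regI < 2 + inf_N reg(N) over the allowed nodes N. *)
Definition subcritical (alpha kappa : R) (g f : jetfun) : Prop :=
  exists regI regXi delta : R,
    [/\ regXi < -2 + alpha - kappa, 0 < delta &
      forall s : seq (mi d),
        (Ds s g <> (fun=> 0) ->
           regI + delta <= 2 + \sum_(a <- s) (regI - (sdeg a)%:R)) /\
        (Ds s f <> (fun=> 0) ->
           regI + delta <= 2 + (regXi + \sum_(a <- s) (regI - (sdeg a)%:R)))].

End jets.

Section spacetime.
Variables (R : realType) (d : nat).

(* The coordinate [ord0] is time; functions on the torus are represented by
   functions that are 1-periodic in each of the other coordinates. *)
Definition stpoint := 'rV[R]_d.+1.

Definition time (z : stpoint) : R := z ord0 ord0.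

Definition slab : set stpoint := [set z | 0 < time z < 1].

Definition space_periodic (u : stpoint -> R) : Prop :=
  forall (i : 'I_d.+1) (z : stpoint), i != ord0 ->
    u (z + delta_mx ord0 i) = u z.

Definition partial (i : 'I_d.+1) (u : stpoint -> R) : stpoint -> R :=
  fun z => 'D_(delta_mx ord0 i) u z.

Definition dmi (a : mi d) (u : stpoint -> R) : stpoint -> R := iter_dir partial a u.

Definition jet (phi : stpoint -> R) (z : stpoint) : mi d -> R := fun a => dmi a phi z.

Definition smooth_on (A : set stpoint) (u : stpoint -> R) : Prop :=
  forall (s : seq 'I_d.+1) (z : stpoint), A z ->
    {for z, continuous (foldr partial u s)} /\
    forall i, derivable (foldr partial u s) z (delta_mx ord0 i).

Definition heat_adj (u : stpoint -> R) : stpoint -> R :=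
  fun z => - partial ord0 u z
           - \sum_(i < d.+1 | i != ord0) partial i (partial i u) z.

End spacetime.

(* The uniform probability on the cube [0,1]^n. *)
Section cube.
Variable R : realType.

Definition tcons n (x : measurableTypeR R * n.-tuple (measurableTypeR R)) :
    n.+1.-tuple (measurableTypeR R) := [tuple of x.1 :: x.2].

Lemma measurable_tcons n : measurable_fun setT (@tcons n).
Proof. by apply: measurable_cons; [exact: measurable_fst|exact: measurable_snd]. Qed.

HB.instance Definition _ n := isMeasurableFun.Build _ _ _ _ (@tcons n) (@measurable_tcons n).

Fixpoint cube_prob n : probability (n.-tuple (measurableTypeR R)) R :=
  if n is m.+1
  then distribution (uniform_prob (@ltr01 R) \x cube_prob m)%E (@tcons m)
  else \d_([tuple] : 0.-tuple (measurableTypeR R)).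

End cube.

Section integration.
Variables (R : realType) (d : nat).
Implicit Types (u h K : stpoint R d -> R).

Definition to_stpoint (w : d.+1.-tuple (measurableTypeR R)) : stpoint R d :=
  \row_i tnth w i.

(* Integration over [0,1] x T^d; the end points of the time interval form a
   null set. *)
Definition slab_integrable u : Prop :=
  (cube_prob R d.+1).-integrable [set w | slab (to_stpoint w)]
    (fun w => (u (to_stpoint w))%:E).

Definition slab_int u : R :=
  \int[cube_prob R d.+1]_(w in [set w | slab (to_stpoint w)]) u (to_stpoint w).

Definition conv K h : stpoint R d -> R :=
  fun z => slab_int (fun w => K (z - w) * h w).

(* L G = delta_0 on (-oo,1) x T^d in the sense of distributions, with G = 0 for
   nonpositive times. *)
Definition green_kernel (G : stpoint R d -> R) : Prop :=
  [/\ space_periodic G,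
      (forall z, time z <= 0 -> G z = 0),
      slab_integrable G &
      forall eta : stpoint R d -> R, smooth_on setT eta -> space_periodic eta ->
        (exists2 T : R, T < 1 & forall z, T <= time z -> eta z = 0) ->
        slab_int (fun z => G z * heat_adj eta z) = eta 0].

(* L u = h on (0,1) x T^d in the sense of distributions. *)
Definition solves_heat u h : Prop :=
  forall eta : stpoint R d -> R, smooth_on setT eta -> space_periodic eta ->
    (exists t0 t1 : R, [/\ 0 < t0, t1 < 1 &
       forall z, ~~ (t0 < time z < t1) -> eta z = 0]) ->
    slab_int (fun z => u z * heat_adj eta z) = slab_int (fun z => h z * eta z).

Definition cutoff (chi : R -> R) : Prop :=
  [/\ (forall n x, {for x, continuous (derive1n n chi)} /\ derivable (derive1n n chi) x 1),
      {homo chi : x y / x <= y},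
      (forall t, 0 <= t <= 1 -> chi t = 0) &
      (forall t, 2 <= t -> chi t = 1)].

Definition Gmu (chi : R -> R) (G : stpoint R d -> R) (mu : R) : stpoint R d -> R :=
  fun z => if mu == 0 then G z else chi (time z / mu ^+ 2) * G z.

End integration.

Section model.
Variables (R : realType) (d : nat).
Variables (g f : jetfun R d) (ell : seq (tree d) -> R).
Variables (chi : R -> R) (G xi : stpoint R d -> R) (mu : R).

Definition functional := (stpoint R d -> R) -> stpoint R d -> R.

Definition ellUps (t : ptree d) : functional :=
  fun phi z => ell [:: \pi_(tree d)%qT (down t)] * pUps g f t (jet phi z).

(* Pi^(R x) of t, given the values [Pi] of Pi^R on the smaller trees.  The
   polynomial and the grey edges of t are not looked at: the right factors of
   [Delta] have none.  The derivative of the singular kernel G - G_mu is taken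
   in the sense of distributions, d^a K * h being d^a (K * h). *)
Definition PiX_step (Pi : ptree d -> functional) (t : ptree d) : functional :=
  fun phi z =>
    (if pnoise t is Xi then xi z else 1) *
    \prod_(b <- pbranches t)
      dmi b.1 (conv (fun w => G w - Gmu chi G mu w) (Pi b.2 phi)) z.

Fixpoint pPiR (n : nat) (t : ptree d) : functional :=
  fun phi z =>
    \sum_(p \in [set: ptree d * ptree d])
      Mloc_Delta R t p * ellUps p.1 phi z *
      PiX_step (if n is m.+1 then pPiR m else fun _ _ _ => 0) p.2 phi z.

(* The right factors of Delta t are at most as high as t, so that [height] many
   steps of the recursion are enough. *)
Definition PiR (s : tree d) : functional := pPiR (height (repr s)) (repr s).

Definition force : functional :=
  fun phi z => \sum_(s \in trees0) (symf s)%:R^-1 * PiR s phi z.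

End model.

Section equation.
Variables (R : realType) (d : nat).

(* Characters of the algebra of forests, whose product is the disjoint union;
   its generators are the trees. *)
Definition character (ell : seq (tree d) -> R) : Prop :=
  ell [::] = 1 /\ forall F1 F2, ell (F1 ++ F2) = ell F1 * ell F2.

Definition renorm_character (alpha kappa : R) (ell : seq (tree d) -> R) : Prop :=
  [/\ character ell,
      ell [:: tone] = 1,
      (forall s, treesX s -> s != tone -> 0 <= deg alpha kappa s -> ell [:: s] = 0) &
      ell [:: tXi] = 0].

(* In the sum of the ell(sigma) / S(sigma) Upsilon[sigma] the term of
   sigma = Xi is f xi_eps: it comes from the part Xibar (x) Xi of Delta Xi, while
   Xi (x) 1 contributes ell(Xi) f = 0. *)
Definition coeff (ell : seq (tree d) -> R) (xi : stpoint R d -> R)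
    (s : tree d) (z : stpoint R d) : R :=
  if s == tXi then xi z else ell [:: s].

Definition coarse_solution (G : stpoint R d -> R) (F : functional R d)
    (phi : stpoint R d -> R) : Prop :=
  [/\ smooth_on (@slab R d) phi, space_periodic phi, slab_integrable (F phi) &
      forall z, slab z -> phi z = conv G (F phi) z].

End equation.

(* Main.v *)
Require Import Defs.
From mathcomp Require Import all_boot all_order all_algebra.
From mathcomp Require Import all_classical all_reals all_analysis.
From mathcomp Require Import measurable_realfun.
From mathcomp Require Import ring lra.
Import Order.TTheory GRing.Theory Num.Theory.
Import numFieldNormedType.Exports.
Local Open Scope classical_set_scope.
Local Open Scope ring_scope.
Set Implicit Arguments.
Unset Strict Implicit.
Unset Printing Implicit Defensive.

(** At scale [mu = 0] the kernel [G - G_mu] is zero, so [Pi^(R x)] kills every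
tree that has a branch.  Among the right factors produced by root extraction
only [1] and [Xi] survive: [1] leaves the whole tree [tau] on the left, and
[Xi] leaves [tau] with its root noise turned into [Xibar]
([Delta_branchless]).  Localisation then puts a factor [X^k / k!] on every node
([Mloc_strip]).  Hence [Pi^R tau] is the sum of
[ell(u) Upsilon(u) / prod_v k_v!] over the planar trees [u] whose polynomials
[k_v] can be stripped off to give [tau], plus [f xi] when [tau = Xi]
([PiR_scale_zero]).

Subcriticality makes all this finite and removes what is not on the right-hand
side.  Let [r] be the regularity [alpha - kappa] of the stochastic convolution
(or [2] if [f = 0]).  A node that is allowed by the equation and carries
[n >= 1] branches of regularity at least [r] again gives a branch of regularity
at least [r + eta n], for a fixed [eta > 0] ([subcritical_gain]).  By induction
the degree of a tree with [Upsilon <> 0] grows linearly in its size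
([pdeg_lower_bound]), so that only finitely many of them have degree [<= 0].
The same estimate shows that a polynomial leaf below a branch makes the degree
positive ([pdeg_bare_leaf]): such trees cannot come from localisation, because
[I_a(1) = 0], but [ell] does not see them either.  It also shows that a product
of branches next to a noise has positive degree, so that [ell] kills all terms
containing [Xibar] except [Xibar] itself ([xibar_support]).

It remains to regroup planar trees by isomorphism class.  The group of
automorphisms of the stripped tree acts on its decorations, and the
orbit-stabiliser relation turns the factors [1 / S(tau)] and [1 / prod_v k_v!]
into [1 / S(sigma)] ([count_decorate], [class_sum]).  For this [Upsilon] has to
be a function of the class, which is the symmetry of second derivatives
([schwarz]).  The result is [PiR_expansion].

For the equation itself, [phi = G * F] is tested against [L^* eta].  Fubini and
the translation invariance of the integral over space-time
([Rintegral_exchange]) reduce the claim to the equation of the Green kernel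
tested against the translates of [eta] ([conv_solves_heat]). *)

(** * Planar representatives and isomorphism *)

(** The generated induction principle says nothing about the subtrees stored in the
list of branches. *)
Lemma ptree_ind_in d (P : ptree d -> Prop) :
  (forall k n gs (bs : seq (mi d * ptree d)),
     (forall b, b \in bs -> P b.2) -> P (Node k n gs bs)) ->
  forall t, P t.
Proof.
move=> H; have Q bs : foldr (fun b Q => P b.2 /\ Q) True bs ->
    forall b : mi d * ptree d, b \in bs -> P b.2.
  elim: bs => [_ b|c bs IHbs [Pc /IHbs Pbs] b]; first by rewrite in_nil.
  by rewrite inE => /predU1P[->|/Pbs].
fix IH 1 => -[k n gs bs]; apply: H; apply: Q.
elim: bs => [|[a t] bs IHbs]; first exact: I.
by split; [exact: IH|exact: IHbs].
Qed.

Definition branch_classes d (bs : seq (mi d * ptree d)) : seq (mi d * tree d) :=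
  [seq (b.1, \pi_(tree d)%qT b.2) | b <- bs].

Lemma pi_isoP d (t u : ptree d) :
  reflect (tree_iso t u) (\pi_(tree d)%qT t == \pi_(tree d)%qT u).
Proof.
apply: (iffP eqP) => [/eqmodP /asboolP//|tu]; apply/eqmodP; exact/asboolP.
Qed.

Lemma repr_iso d (t : ptree d) : tree_iso t (repr (\pi_(tree d)%qT t)).
Proof. by apply/pi_isoP; rewrite reprK. Qed.

Lemma tree_iso_branches d k n gs (bs bs' : seq (mi d * ptree d)) :
  branch_classes bs = branch_classes bs' -> tree_iso (Node k n gs bs) (Node k n gs bs').
Proof.
suff H l : branch_classes bs = branch_classes bs' ->
    tree_iso (Node k n gs (l ++ bs)) (Node k n gs (l ++ bs')) by exact: (H [::]).
elim: bs bs' l => [|[a t] bs IH] [|[a' t'] bs'] l //=; first by move=> _; exact: iso_refl.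
move=> -[<- tt' bsbs'].
have mid t0 : tree_iso (Node k n gs (l ++ (a, t0) :: bs'))
    (Node k n gs ((a, t0) :: (l ++ bs'))).
  by apply: iso_perm => //; rewrite -cat1s perm_catCA.
have := IH _ (rcons l (a, t)) bsbs'; rewrite !cat_rcons => /iso_trans; apply.
apply: iso_trans (mid t) _; apply: iso_trans (iso_sym (mid t')).
by apply: iso_branch; apply/pi_isoP/eqP.
Qed.

(** Isomorphism is decided at the root: the branches have to agree as multisets of
pairs of a label and a class.  This is what makes the recursion over trees below
possible. *)
Lemma tree_isoP d k n gs bs k' n' gs' (bs' : seq (mi d * ptree d)) :
  tree_iso (Node k n gs bs) (Node k' n' gs' bs') <->
  [/\ k = k', n = n', perm_eq gs gs' & perm_eq (branch_classes bs) (branch_classes bs')].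
Proof.
split=> [|[-> -> gsgs' /(perm_iotaP ((mi0 d), tone))[s ps e]]].
  pose P (t u : ptree d) := let: Node k n gs bs := t in
    let: Node k' n' gs' bs' := u in
    [/\ k = k', n = n', perm_eq gs gs' & perm_eq (branch_classes bs) (branch_classes bs')].
  suff : forall t u, tree_iso t u -> P t u by move=> /[apply].
  move=> t u; elim=> {t u k n gs bs k' n' gs' bs'}.
  - by case=> k n gs bs; split.
  - by move=> [k n gs bs] [k' n' gs' bs'] /= _ [-> -> ? ?]; split => //; rewrite perm_sym.
  - move=> [k n gs bs] [k' n' gs' bs'] [k'' n'' gs'' bs''] /= _ [-> -> ? ?] _ [-> -> ? ?].
    by split => //; apply: perm_trans; eassumption.
  - by move=> k n gs gs' bs bs' ? ?; split => //; exact: perm_map.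
  - by move=> k n gs a t u bs /pi_isoP /eqP tu; split; rewrite //= tu.
have sz : size bs' = size (branch_classes bs') by rewrite size_map.
have /iso_trans : tree_iso (Node k' n' gs bs)
    (Node k' n' gs [seq nth (mi0 d, pone d) bs' i | i <- s]).
  apply: tree_iso_branches; rewrite [LHS]e /branch_classes -[RHS]map_comp; apply/eq_in_map => i.
  rewrite (perm_mem ps) mem_iota add0n -sz => /= ibs'.
  by rewrite (nth_map (mi0 d, pone d)).
apply; apply: iso_perm => //; rewrite -sz in ps.
by apply: (perm_trans (perm_map _ ps)); rewrite -/(mkseq _ _) mkseq_nth.
Qed.

(** Compatibility with the two generators of [tree_iso] is enough for a map to
descend to the quotient. *)
Lemma iso_invariant d (T : Type) (h : ptree d -> T) :
  (forall k n (gs gs' : seq (mi d * mi d)) (bs bs' : seq (mi d * ptree d)),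
     perm_eq gs gs' -> perm_eq bs bs' ->
     h (Node k n gs bs) = h (Node k n gs' bs')) ->
  (forall k n gs a t u bs, tree_iso t u -> h t = h u ->
     h (Node k n gs ((a, t) :: bs)) = h (Node k n gs ((a, u) :: bs))) ->
  forall t u, tree_iso t u -> h t = h u.
Proof.
by move=> hp hb t u; elim=> // {}t {}u v _ -> _ ->.
Qed.

Lemma perm_foldr (T : eqType) (U : Type) (op : T -> U -> U) (x : U) :
  (forall a b y, op a (op b y) = op b (op a y)) ->
  forall s s', perm_eq s s' -> foldr op x s = foldr op x s'.
Proof.
move=> opC s; elim: s => [|a s IH] s'.
  by move=> /perm_size /esym/size0nil ->.
move=> e; have /splitPr as' : a \in s' by rewrite -(perm_mem e) mem_head.
case: as' e => s1 s2; rewrite perm_sym -cat1s perm_catCA /= perm_cons perm_sym => /IH /= ->.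
elim: s1 => //= c s1 IH1; by rewrite -IH1 opC.
Qed.

Lemma pone_iso d (t : ptree d) : tree_iso t (pone d) -> t = pone d.
Proof.
case: t => k n gs bs /tree_isoP[-> -> /perm_size/size0nil -> /perm_size].
by rewrite !size_map => /size0nil ->.
Qed.

Lemma pXi_iso d (t : ptree d) : tree_iso t (pXi d) -> t = pXi d.
Proof.
case: t => k n gs bs /tree_isoP[-> -> /perm_size/size0nil -> /perm_size].
by rewrite !size_map => /size0nil ->.
Qed.

Lemma repr_tone d : repr (@tone d) = pone d.
Proof. by apply: pone_iso; exact/iso_sym/repr_iso. Qed.

Lemma repr_tXi d : repr (@tXi d) = pXi d.
Proof. by apply: pXi_iso; exact/iso_sym/repr_iso. Qed.

Lemma in_TX_iso d (t u : ptree d) : tree_iso t u -> in_TX t = in_TX u.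
Proof.
move: t u; apply: iso_invariant => [k n gs gs' bs bs' pg pb|k n gs a t u bs tu e] /=.
  by rewrite /nilp (perm_size pg) (perm_all _ pb).
rewrite e; do 4!congr (_ && _); congr (~~ _).
apply/eqP/eqP => ?; subst; [exact/pone_iso/iso_sym|exact: pone_iso].
Qed.

Lemma no_poly_iso d (t u : ptree d) : tree_iso t u -> no_poly t = no_poly u.
Proof.
move: t u; apply: iso_invariant => [k n gs gs' bs bs' pg pb|k n gs a t u bs tu e] /=.
  by rewrite (perm_all _ pb).
by rewrite e.
Qed.

Lemma psym_iso d (t u : ptree d) : tree_iso t u -> psym t = psym u.
Proof.
move: t u; apply: iso_invariant => [k n gs gs' bs bs' pg pb|k n gs a t u bs tu e] /=.
  congr (_ * _ * _)%N.
    by apply: perm_foldr pb => a b y; rewrite !mulnA; congr (_ * _)%N; rewrite mulnC.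
  have pc := perm_map (fun b : mi d * ptree d => (b.1, \pi_(tree d)%qT b.2)) pb.
  rewrite (perm_big _ (perm_undup (perm_mem pc))) /=.
  by apply: eq_bigr => c _; rewrite (permP pc).
have /eqP -> : \pi_(tree d)%qT t == \pi_(tree d)%qT u by apply/pi_isoP.
by rewrite e.
Qed.

Lemma pdeg_iso d (R : realType) (alpha kappa : R) (t u : ptree d) :
  tree_iso t u -> pdeg alpha kappa t = pdeg alpha kappa u.
Proof.
move: t u; apply: iso_invariant => [k n gs gs' bs bs' pg pb|k n gs a t u bs tu e] /=.
  by congr (_ + _); apply: perm_foldr pb => a b y; exact: addrCA.
by rewrite e.
Qed.

(** * Counting polynomial decorations up to isomorphism *)

Fixpoint strip d (t : ptree d) : ptree d :=
  let: Node k n gs bs := t in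
  Node (mi0 d) n gs [seq (b.1, strip b.2) | b <- bs].

Fixpoint decfact d (t : ptree d) : nat :=
  let: Node k n gs bs := t in
  (mi_fact k * foldr (fun b m => decfact b.2 * m) 1 bs)%N.

Fixpoint node_decs d (t : ptree d) : seq (mi d) :=
  let: Node k n gs bs := t in k :: foldr (fun b l => node_decs b.2 ++ l) [::] bs.

Definition seqprods (T : Type) (L : seq (seq T)) : seq (seq T) :=
  foldr (fun l P => [seq x :: y | x <- l, y <- P]) [:: [::]] L.

(** A finite stand-in for the fibre of [strip] over [t]: only polynomial
decorations from [K] are used. *)
Fixpoint decorate d (K : seq (mi d)) (t : ptree d) : seq (ptree d) :=
  let: Node _ n gs bs := t in
  [seq Node k n gs bs' | k <- K,
     bs' <- seqprods [seq [seq (b.1, u) | u <- decorate K b.2] | b <- bs]].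

(** The order of the stabiliser of the word [s] under permutations of its positions. *)
Definition multfact (T : eqType) (s : seq T) : nat :=
  (\prod_(c <- undup s) (count_mem c s)`!)%N.

Lemma multfact_cons (T : eqType) (c : T) s :
  multfact (c :: s) = (multfact s * (count_mem c s).+1)%N.
Proof.
have -> : multfact s = (\prod_(e <- undup (c :: s)) (count_mem e s)`!)%N.
  rewrite /multfact /=; case: ifP => // /negbT cs.
  by rewrite big_cons (count_memPn cs) fact0 mul1n.
have cu : c \in undup (c :: s) by rewrite mem_undup mem_head.
rewrite /multfact !(bigD1_seq c) ?undup_uniq //= eqxx add1n factS -mulnA mulnC.
congr (_ * _ * _)%N; apply: eq_bigr => e /negPf ec.
by rewrite eq_sym ec.
Qed.

Lemma multfact_perm (T : eqType) (s s' : seq T) :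
  perm_eq s s' -> multfact s = multfact s'.
Proof.
move=> p; rewrite /multfact (perm_big _ (perm_undup (perm_mem p))) /=.
by apply: eq_bigr => c _; rewrite (permP p).
Qed.

Lemma multfact_gt0 (T : eqType) (s : seq T) : (0 < multfact s)%N.
Proof. by rewrite prodn_gt0 // => c; exact: fact_gt0. Qed.

Lemma count_allpairs (S T U : Type) (f : S -> T -> U) (P : pred U) s t :
  count P [seq f x y | x <- s, y <- t] = (\sum_(x <- s) count (P \o f x) t)%N.
Proof.
elim: s => [|x s IH] /=; first by rewrite big_nil.
by rewrite big_cons count_cat IH count_map.
Qed.

(** Both sides sum [h] over the letters of [L] whose class lies in [cs]. *)
Lemma sum_by_class (T C : eqType) (kap : T -> C) (L : seq T) (cs : seq C) (h : C -> nat) :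
  (\sum_(x <- L) (if kap x \in cs then h (kap x) else 0) =
   \sum_(c <- undup cs) count (fun x => kap x == c) L * h c)%N.
Proof.
elim: L => [|x L IH] /=; first by rewrite big_nil big1.
rewrite big_cons IH -mem_undup.
under [in RHS]eq_bigr do rewrite mulnDl.
rewrite big_split /=; congr addn; case: ifPn => [xc|xc].
  rewrite (bigD1_seq (kap x)) ?undup_uniq //= eqxx mul1n big1 ?addn0 // => c.
  by rewrite eq_sym => /negPf ->.
by rewrite big_seq big1 // => c cc; case: eqP => // e; rewrite e cc in xc.
Qed.

(** One node of the orbit-stabiliser relation.  The words [xs] with one letter from
each row and with prescribed multiset [cs] of classes are counted.  Each row [r]
carries the label [r.2.1] of its letters and a weight; a class [c] with label
[phi c] has [r.2.2 / v c] letters in each row with that label and none in the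
others.  Choosing the class [c] of the first letter leaves the multiset
[rem c cs], and the multiplicities of the classes with a given label add up to the
multiplicity of the label. *)
Lemma count_arrangements (F : numFieldType) (T C Y : eqType) (kap : T -> C)
    (phi : C -> Y) (v : C -> F) (rows : seq (seq T * (Y * F))) (cs : seq C) :
  (forall r c, r \in rows -> c \in cs ->
    (count (fun x => kap x == c) r.1)%:R * v c
      = if phi c == r.2.1 then r.2.2 else 0) ->
  (count (fun xs => perm_eq (map kap xs) cs) (seqprods (map fst rows)))%:R
    * \prod_(c <- cs) v c * (multfact cs)%:R
  = if perm_eq (map phi cs) [seq r.2.1 | r <- rows]
    then \prod_(r <- rows) r.2.2 * (multfact [seq r.2.1 | r <- rows])%:R else 0.
Proof.
elim: rows cs => [|[L [y u]] rows IH] cs H.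
  case: cs {H} => [|c cs]; first by rewrite /multfact /= !big_nil addn0 !mul1r.
  have e (U : eqType) (s t : seq U) : size s != size t -> perm_eq s t = false.
    by move=> st; apply/negP => /perm_size /eqP; apply/negP.
  by rewrite !e //= e // !mul0r.
rewrite /= count_allpairs.
have -> : (\sum_(x <- L) count ((fun xs => perm_eq (map kap xs) cs) \o cons x)
    (seqprods [seq r.1 | r <- rows]) = \sum_(x <- L) (if kap x \in cs then
      count (fun xs => perm_eq (map kap xs) (rem (kap x) cs))
        (seqprods [seq r.1 | r <- rows]) else 0))%N.
  apply: eq_bigr => x _; case: ifPn => xcs.
    by apply: eq_count => xs /=; rewrite (permPr (perm_to_rem xcs)) perm_cons.
  rewrite -(count_pred0 (seqprods [seq r.1 | r <- rows])); apply: eq_count => xs /=.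
  by apply/negP => /perm_mem /(_ (kap x)); rewrite mem_head (negPf xcs).
rewrite (sum_by_class kap L cs (fun c => count (fun xs => perm_eq (map kap xs)
  (rem c cs)) (seqprods [seq r.1 | r <- rows]))) natr_sum !mulr_suml.
(* The words whose first letter is in the class c. *)
have E c : c \in cs ->
    (count (fun x => kap x == c) L * count (fun xs => perm_eq (map kap xs)
      (rem c cs)) (seqprods [seq r.1 | r <- rows]))%:R * \prod_(c <- cs) v c
      * (multfact cs)%:R
    = if (phi c == y) && perm_eq (map phi cs) (y :: [seq r.2.1 | r <- rows])
      then u * (\prod_(r <- rows) r.2.2 * (multfact [seq r.2.1 | r <- rows])%:R)
           * (count_mem c cs)%:R
      else 0.
  move=> ccs; have p := perm_to_rem ccs.
  rewrite (perm_big _ p) (multfact_perm p) multfact_cons big_cons !natrM /=.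
  have -> : count_mem c cs = (count_mem c (rem c cs)).+1.
    by rewrite (permP p) /= eqxx.
  set a := (count (fun x => kap x == c) L)%:R; set b := (count _ _)%:R.
  set P := \prod_(c <- _) v c; set m := (multfact _)%:R; set q := _.+1%:R.
  transitivity ((a * v c) * (b * P * m) * q); first by ring.
  rewrite (H (L, (y, u)) c) ?mem_head //= IH; last first.
    by move=> r e rr /mem_rem er; apply: H => //; rewrite inE rr orbT.
  have pe : perm_eq (map phi cs) (phi c :: map phi (rem c cs)) by exact: (perm_map _ p).
  case: eqP => [<-|]; last by rewrite !mul0r.
  rewrite andTb [in RHS](permPl pe) perm_cons; case: ifP => _; ring.
transitivity (\sum_(c <- undup cs) if (phi c == y) &&
      perm_eq (map phi cs) (y :: [seq r.2.1 | r <- rows])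
      then u * (\prod_(r <- rows) r.2.2 * (multfact [seq r.2.1 | r <- rows])%:R)
           * (count_mem c cs)%:R
      else 0).
  by apply: eq_big_seq => c; rewrite mem_undup => /E.
case: ifP => [pe|_]; last by rewrite big1 // => c _; rewrite andbF.
under [LHS]eq_bigr do rewrite andbT.
rewrite -big_mkcond -mulr_sumr /= big_cons multfact_cons natrM.
have -> : \sum_(c <- undup cs | phi c == y) (count_mem c cs)%:R
   = (count_mem y [seq r.2.1 | r <- rows]).+1%:R :> F.
  have := permP pe (pred1 y); rewrite /= eqxx add1n => <-.
  rewrite -natr_sum; congr (_%:R); rewrite count_map.
  transitivity (\sum_(x <- cs) if id x \in cs then nat_of_bool (phi x == y) else 0)%N.
    rewrite (sum_by_class id cs cs (fun c => nat_of_bool (phi c == y))) big_mkcond /=.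
    by apply: eq_bigr => c _; case: eqP; rewrite ?muln1 ?muln0.
  rewrite -sum1_count [RHS]big_mkcond; apply: eq_big_seq => x /= ->.
  by case: eqP.
by rewrite /=; ring.
Qed.

Lemma strip_iso d (t u : ptree d) : tree_iso t u -> tree_iso (strip t) (strip u).
Proof.
move=> tu; apply/pi_isoP/eqP.
move: t u tu; apply: iso_invariant => [k n gs gs' bs bs' pg pb|k n gs a t u bs tu e].
  apply/eqP/pi_isoP; apply: iso_perm => //; exact: perm_map.
by apply/eqP/pi_isoP; apply: iso_branch; apply/pi_isoP/eqP.
Qed.

Lemma decfact_iso d (t u : ptree d) : tree_iso t u -> decfact t = decfact u.
Proof.
move: t u; apply: iso_invariant => [k n gs gs' bs bs' pg pb|k n gs a t u bs tu e] /=.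
  by congr (_ * _)%N; apply: perm_foldr pb => a b y; exact: mulnCA.
by rewrite e.
Qed.

Lemma all_node_decs d (K : {pred mi d}) (bs : seq (mi d * ptree d)) :
  all [in K] (foldr (fun b l => node_decs b.2 ++ l) [::] bs)
  = all (fun b => all [in K] (node_decs b.2)) bs.
Proof. by elim: bs => //= b bs IH; rewrite all_cat IH. Qed.

Lemma node_decs_iso d (t u : ptree d) (K : {pred mi d}) : tree_iso t u ->
  all [in K] (node_decs t) = all [in K] (node_decs u).
Proof.
move: t u; apply: iso_invariant => [k n gs gs' bs bs' pg pb|k n gs a t u bs tu e] /=.
  by congr (_ && _); rewrite !all_node_decs; exact: perm_all.
by rewrite !all_cat e.
Qed.

Lemma mi_fact_mi0 d : mi_fact (mi0 d) = 1%N.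
Proof. by apply: big1 => i _; rewrite ffunE. Qed.

Lemma sdeg_mi0 d : sdeg (mi0 d) = 0%N.
Proof. by apply: big1 => i _; rewrite ffunE muln0. Qed.

Lemma mi_fact_gt0 d (k : mi d) : (0 < mi_fact k)%N.
Proof. by rewrite prodn_gt0 // => i; exact: fact_gt0. Qed.

Lemma decfact_gt0 d (t : ptree d) : (0 < decfact t)%N.
Proof.
elim/ptree_ind_in: t => k n gs bs IH /=.
rewrite muln_gt0 mi_fact_gt0 /=.
elim: bs IH => //= b bs IHb IH; rewrite muln_gt0 IH ?mem_head //=.
by apply: IHb => c cb; apply: IH; rewrite inE cb orbT.
Qed.

Lemma psymE d k n gs (bs : seq (mi d * ptree d)) :
  psym (Node k n gs bs)
  = (mi_fact k * (\prod_(b <- bs) psym b.2) * multfact (branch_classes bs))%N.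
Proof.
rewrite /= -/(multfact (branch_classes bs)); congr (_ * _ * _)%N.
by elim: bs => [|b bs IH]; rewrite ?big_nil // big_cons -IH.
Qed.

Lemma psym_gt0 d (t : ptree d) : (0 < psym t)%N.
Proof.
elim/ptree_ind_in: t => k n gs bs IH; rewrite psymE !muln_gt0 multfact_gt0 mi_fact_gt0 andbT.
by rewrite big_seq; apply: prodn_cond_gt0 => b; exact: IH.
Qed.

Lemma seqprodsP (T : eqType) (L : seq (seq T)) (xs : seq T) :
  (xs \in seqprods L) = all2 (fun x l => x \in l) xs L.
Proof.
elim: L xs => [|l L IH] [|x xs] //=.
  by apply/allpairsP => -[[a b] /= [_ _]].
apply/allpairsP/andP => [[[a b] /= [al bL [-> ->]]]|[xl]]; first by rewrite -IH.
by rewrite -IH => xsL; exists (x, xs).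
Qed.

Lemma seqprods_uniq (T : eqType) (L : seq (seq T)) : all uniq L -> uniq (seqprods L).
Proof.
elim: L => //= l L IH /andP[ul /IH uL]; apply: allpairs_uniq => //.
by move=> [a b] [a' b'] _ _ /= [-> ->].
Qed.

Lemma decorate_uniq d (K : seq (mi d)) t : uniq K -> uniq (decorate K t).
Proof.
move=> uK; elim/ptree_ind_in: t => k n gs bs IH /=; apply: allpairs_uniq => //.
  apply: seqprods_uniq; apply/allP => l /mapP[b bbs ->].
  by rewrite map_inj_uniq; [exact: IH|move=> x y [->]].
by move=> [a b] [a' b'] _ _ /= [-> ->].
Qed.

Lemma mem_decorate d (K : seq (mi d)) t u : no_poly t ->
  (u \in decorate K t) = (strip u == t) && all [in K] (node_decs u).
Proof.
elim/ptree_ind_in: t u => k n gs bs IH [k' n' gs' bs'] /= /andP[/eqP -> np].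
have -> : (Node k' n' gs' bs' \in
    [seq Node k1 n gs bs1 | k1 <- K, bs1 <- seqprods
      [seq [seq (b.1, u) | u <- decorate K b.2] | b <- bs]])
   = [&& k' \in K, n' == n, gs' == gs & bs' \in seqprods
      [seq [seq (b.1, u) | u <- decorate K b.2] | b <- bs]].
  apply/allpairsP/and4P => [[[a b] /= [aK bL [-> -> -> ->]]]|[? /eqP-> /eqP-> ?]] //.
  by exists (k', bs').
rewrite seqprodsP.
have -> : all2 (fun x l => x \in l) bs'
     [seq [seq (b.1, u) | u <- decorate K b.2] | b <- bs]
   = ([seq (b.1, strip b.2) | b <- bs'] == bs) &&
     all [in K] (foldr (fun b l => node_decs b.2 ++ l) [::] bs').
  elim: bs' bs IH np {k k' n n' gs gs'} => [|[a u] bs' IHb] [|[b t] bs] IH //= /andP[npt np].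
  rewrite all_cat IHb //; last by move=> c cb; apply: IH; rewrite inE cb orbT.
  have -> : ((a, u) \in [seq (b, u0) | u0 <- decorate K t]) =
      (a == b) && (u \in decorate K t).
    apply/mapP/andP => [[x xK [-> ->]]//|[/eqP -> ?]].
    by exists u.
  rewrite (IH (b, t)) ?mem_head //= eqseq_cons xpair_eqE !andbA; congr (_ && _).
  exact: andbAC.
apply/and4P/andP => [[kK /eqP -> /eqP -> /andP[/eqP -> ->]]|[/eqP[-> -> <-] /andP[-> ->]]].
  by rewrite eqxx kK.
by rewrite !eqxx.
Qed.

(** Orbit-stabiliser.  Without the factors [k!], [psym] is the number of
automorphisms; the automorphisms of [t] act on its decorations, and those that fix
a decoration are the automorphisms of the decorated tree.  So the number of
decorations of [t] in the class of [s] is a quotient of two symmetry factors, up to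
the factors [k!] of [s].  The proof goes by induction on [t], one node being
[count_arrangements]. *)
Lemma count_decorate (F : numFieldType) d (K : seq (mi d)) (t s : ptree d) :
  uniq K -> no_poly t -> all [in K] (node_decs s) ->
  (count (fun p => \pi_(tree d)%qT p == \pi_(tree d)%qT s) (decorate K t))%:R
    * ((psym s)%:R / (decfact s)%:R)
  = if \pi_(tree d)%qT (strip s) == \pi_(tree d)%qT t then (psym t)%:R else 0 :> F.
Proof.
move=> uK; elim/ptree_ind_in: t s => k n gs bs IH [ks ns gss bss].
rewrite (psymE ks) (psymE k) /= => /andP[/eqP-> np] /andP[ksK decs_bss].
pose v (c : mi d * tree d) : F := (psym (repr c.2))%:R / (decfact (repr c.2))%:R.
pose phi (c : mi d * tree d) := (c.1, \pi_(tree d)%qT (strip (repr c.2))).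
pose kap (x : mi d * ptree d) := (x.1, \pi_(tree d)%qT x.2).
pose rows := [seq ([seq (b.1, u) | u <- decorate K b.2],
   ((b.1, \pi_(tree d)%qT b.2), (psym b.2)%:R : F)) | b <- bs].
have := @count_arrangements F _ _ _ kap phi v rows (branch_classes bss).
have vE b : v (b.1, \pi_(tree d)%qT b.2) = (psym b.2)%:R / (decfact b.2)%:R.
  by rewrite /v /= -(psym_iso (repr_iso b.2)) -(decfact_iso (repr_iso b.2)).
have phiE b : phi (b.1, \pi_(tree d)%qT b.2) = (b.1, \pi_(tree d)%qT (strip b.2)).
  congr pair; apply/eqP/pi_isoP; apply: strip_iso; exact/iso_sym/repr_iso.
have -> : [seq r.1 | r <- rows] =
    [seq [seq (b.1, u) | u <- decorate K b.2] | b <- bs].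
  by rewrite /rows -map_comp.
have -> : [seq r.2.1 | r <- rows] = branch_classes bs by rewrite /rows -map_comp.
have -> : map phi (branch_classes bss) = branch_classes [seq (b.1, strip b.2) | b <- bss].
  by rewrite /branch_classes -!map_comp; apply: eq_map => b; exact: phiE.
have -> : \prod_(r <- rows) r.2.2 = \prod_(b <- bs) (psym b.2)%:R by rewrite big_map.
have -> : \prod_(c <- branch_classes bss) v c =
    (\prod_(b <- bss) psym b.2)%:R / (\prod_(b <- bss) decfact b.2)%:R :> F.
  rewrite !natr_prod -prodf_div big_map; apply: eq_bigr => b _; exact: vE.
move=> arr; have {}arr := arr _.
rewrite count_allpairs.
have -> : (\sum_(x <- K) count ((fun p => \pi_(tree d)%qT p ==
      \pi_(tree d)%qT (Node ks ns gss bss)) \o Node x n gs)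
    (seqprods [seq [seq (b.1, u) | u <- decorate K b.2] | b <- bs])
  = ((n == ns) && perm_eq gs gss) *
    count (fun xs => perm_eq (map kap xs) (branch_classes bss))
      (seqprods [seq [seq (b.1, u) | u <- decorate K b.2] | b <- bs]))%N.
  rewrite (bigD1_seq ks) //= big1 ?addn0 => [|k' /negPf kk'].
    case: andP => [[/eqP -> pgs]|ng].
      rewrite mul1n; apply: eq_count => xs /=; apply/pi_isoP/idP.
        by move=> /tree_isoP[].
      by move=> ?; apply/tree_isoP.
    rewrite mul0n; apply/eqP; rewrite eqn0Ngt -has_count -all_predC.
    apply/allP => xs _ /=; apply/pi_isoP => /tree_isoP[_ ? ? _].
    by apply: ng; split => //; apply/eqP.
  apply/eqP; rewrite eqn0Ngt -has_count -all_predC.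
  apply/allP => xs _ /=; apply/pi_isoP => /tree_isoP[e].
  by rewrite e eqxx in kk'.
have -> : (\pi_(tree d)%qT (Node (mi0 d) ns gss [seq (b.1, strip b.2) | b <- bss])
    == \pi_(tree d)%qT (Node (mi0 d) n gs bs)) =
  [&& n == ns, perm_eq gs gss &
    perm_eq (branch_classes [seq (b.1, strip b.2) | b <- bss]) (branch_classes bs)].
  rewrite (perm_sym gs); apply/pi_isoP/and3P.
    by move=> /tree_isoP[_ -> -> ->].
  by move=> [/eqP -> ? ?]; apply/tree_isoP.
have foldE (h : ptree d -> nat) (l : seq (mi d * ptree d)) :
    foldr (fun b m => h b.2 * m)%N 1%N l = (\prod_(b <- l) h b.2)%N.
  by elim: l => [|b l IHl]; rewrite ?big_nil // big_cons -IHl.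
rewrite !foldE.
rewrite andbA; case: (_ && _); last by rewrite mul0r.
rewrite mul1n andTb mi_fact_mi0 mul1n.
have nz : (mi_fact ks)%:R != 0 :> F by rewrite pnatr_eq0 -lt0n mi_fact_gt0.
have nzd : (\prod_(b <- bss) decfact b.2)%:R != 0 :> F.
  by rewrite pnatr_eq0 -lt0n big_seq prodn_cond_gt0 // => b _; exact: decfact_gt0.
rewrite -natr_prod -natrM in arr; rewrite -arr ?natrM; first by field; rewrite nz nzd.
move=> r c /mapP[b bbs ->] /mapP[b' b'bss ->] /=.
rewrite vE phiE xpair_eqE.
rewrite count_map; have [e|ne] := eqVneq b'.1 b.1.
  rewrite -IH ?(allP np) //; last by move: decs_bss; rewrite all_node_decs => /allP; exact.
  congr (_%:R * _); apply: eq_count => u /=.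
  by rewrite /kap /= xpair_eqE e eqxx.
rewrite (eq_count (a2 := pred0)) ?count_pred0 ?mul0r // => u /=.
by rewrite /kap /= xpair_eqE eq_sym (negPf ne).
Qed.

(** * Localisation of trees without polynomials *)

(** Sums over infinite index sets are zero by convention when their support is
infinite; here the support is at most one point. *)
Lemma fsum_supp1 (R : numDomainType) (T : choiceType) (A : set T) (x : T) (f : T -> R) :
  (forall y, A y -> y != x -> f y = 0) ->
  \sum_(y \in A) f y = if x \in A then f x else 0.
Proof.
move=> f0; case: ifPn => [/set_mem Ax|xA].
  rewrite -(@fsbig_widen _ _ _ _ [set x]) ?fsbig_set1 //; first by move=> y ->.
  by move=> y [Ay /eqP yx]; exact: f0.
apply: fsbig1 => y Ay; apply: f0 => //; apply/eqP => yx; move: xA.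
by rewrite -yx; apply/negP; rewrite negbK; exact/mem_set.
Qed.

(** Additivity of such sums needs finite supports. *)
Lemma fsum_add_supp1 (R : numDomainType) (T : choiceType) (A : set T) (x1 x2 : T)
    (f1 f2 : T -> R) :
  (forall y, A y -> y != x1 -> f1 y = 0) -> (forall y, A y -> y != x2 -> f2 y = 0) ->
  \sum_(y \in A) (f1 y + f2 y) = \sum_(y \in A) f1 y + \sum_(y \in A) f2 y.
Proof.
move=> h1 h2; have fin : finite_set (A `&` [set` [:: x1; x2]]).
  by apply: finite_setIr; exact: finite_seq.
have w (h : T -> R) : (forall y, A y -> y != x1 -> y != x2 -> h y = 0) ->
    \sum_(y \in A `&` [set` [:: x1; x2]]) h y = \sum_(y \in A) h y.
  move=> h0; apply: fsbig_widen => [y []//|y [Ay ny]] /=.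
  apply: h0 => //; apply/negP => yx; apply: ny; split=> //=.
    by rewrite !inE yx.
  by rewrite !inE yx orbT.
rewrite -!w ?fsbig_split // => y Ay n1 n2; rewrite ?h1 ?h2 ?addr0 //.
Qed.

(** In the products below at most one factorisation of [u] has a nonzero
coefficient. *)
Lemma series_mul_supp1 (R : realType) (T : choiceType) (m : T -> T -> T) (s1 s2 : T -> R)
    (u p q : T) :
  (forall p' q', m p' q' = u -> s1 p' * s2 q' != 0 -> p' = p /\ q' = q) ->
  series_mul m s1 s2 u = if m p q == u then s1 p * s2 q else 0.
Proof.
move=> h; rewrite /series_mul (@fsum_supp1 _ _ _ (p, q)) /=; last first.
  move=> [p' q'] /= e; apply: contraNeq => /(h _ _ e)[-> ->]; exact: eqxx.
have -> // : ((p, q) \in [set x | m x.1 x.2 = u]) = (m p q == u).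
by apply/idP/eqP => [/set_mem|e]; [|exact: mem_set].
Qed.

Lemma series_map_supp1 (R : realType) (T U : choiceType) (A : set T) (h : T -> U)
    (s : T -> R) (t : T) : injective h ->
  series_map A h s (h t) = if t \in A then s t else 0.
Proof.
move=> hi; rewrite /series_map (@fsum_supp1 _ _ _ t) => [|y [_ /hi ->]]; last by rewrite eqxx.
congr (if _ then _ else _); apply/idP/idP => /set_mem => [[At _]|At]; exact: mem_set.
Qed.

Lemma series_map_neq0 (R : realType) (T U : choiceType) (A : set T) (h : T -> U)
    (s : T -> R) (u : U) : series_map A h s u != 0 -> exists t, u = h t.
Proof.
apply: contraPP => nt; apply/negP; rewrite negbK; apply/eqP; apply: fsbig1.
by move=> t [_ e]; case: nt; exists t.
Qed.

Lemma mi_add0 d (k : mi d) : mi_add k (mi0 d) = k.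
Proof. by apply/ffunP => i; rewrite !ffunE addn0. Qed.

Lemma mi_0add d (k : mi d) : mi_add (mi0 d) k = k.
Proof. by apply/ffunP => i; rewrite !ffunE. Qed.

Lemma pI_inj d (a : mi d) : injective (pI a).
Proof. by move=> t u []. Qed.

(** The condition of [in_TX] on the branches only, so that it also applies when the
noise at the root is [Xibar]. *)
Definition planted d (bs : seq (mi d * ptree d)) :=
  all (fun b => (b.2 != pone d) && in_TX b.2) bs.

Lemma in_TX_noXiBar d (t : ptree d) : in_TX t -> ~~ has_XiBar t.
Proof.
elim/ptree_ind_in: t => k n gs bs IH /= /and3P[n1 _ bsT].
rewrite negb_or n1 -all_predC; apply/allP => b bbs /=.
by apply: IH => //; have /andP[] := allP bsT b bbs.
Qed.

Lemma in_TX_plantable d (t : ptree d) : in_TX t -> t != pone d -> plantable t.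
Proof.
move=> tT t1; rewrite /plantable in_TX_noXiBar // andbT; apply: contra t1.
case: t tT => k n gs bs /= /and3P[nB /nilP -> _] /and3P[/eqP -> nX /nilP ->].
by case: n nB nX; rewrite ?eqxx // => _ _; apply/eqP.
Qed.

Lemma has_XiBar_strip d (t : ptree d) : has_XiBar (strip t) = has_XiBar t.
Proof.
elim/ptree_ind_in: t => k n gs bs IH /=; congr orb; rewrite has_map.
by apply: eq_in_has => b /IH.
Qed.

Lemma plantable_strip d (t : ptree d) : plantable (strip t) -> plantable t.
Proof.
rewrite /plantable has_XiBar_strip => /andP[g ->]; rewrite andbT.
apply: contra g; case: t => k n gs bs /= /and3P[_ -> /nilP ->].
by rewrite eqxx.
Qed.

(** The product over the branches, before the root receives its polynomial.  A
planar product of planted trees determines its factors from the left, which is why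
no multiplicities occur. *)
Lemma Mloc_branches (R : realType) d n gs (bs : seq (mi d * ptree d)) k' n' gs' bs' :
  planted bs ->
  (forall b u, b \in bs ->
     Mloc R b.2 u = if strip u == b.2 then (decfact u)%:R^-1 else 0) ->
  foldr (fun b s => series_mul (@pmul d)
      (series_map [set u | plantable u] (pI b.1) (Mloc R b.2)) s)
    (@monomial R (ptree d) (Node (mi0 d) n gs [::])) bs (Node k' n' gs' bs')
  = if [&& k' == mi0 d, n' == n, gs' == gs & [seq (b.1, strip b.2) | b <- bs'] == bs]
    then (foldr (fun b m => decfact b.2 * m)%N 1%N bs')%:R^-1 else 0.
Proof.
elim: bs bs' => [|[a t] bs IH] bs' /=.
  move=> _ _; rewrite /monomial; case: and4P => [[/eqP -> /eqP -> /eqP ->]|ne].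
    by case: bs' => //; rewrite eqxx invr1.
  case: eqP => // -[? ? ? ?]; subst; case: ne; by split.
move=> /andP[/andP[/= t1 tT] plbs] HM; set A := series_map _ _ _; set B := foldr _ _ _.
have AE u : A u != 0 -> exists v, u = pI a v by exact: series_map_neq0.
case: bs' => [|[a' t'] l].
  rewrite !andbF /series_mul; apply: fsbig1 => -[p q] /= pq; have [->|] := eqVneq (A p) 0.
    by rewrite mul0r.
  by move=> /AE[v e]; move: pq; rewrite e; case: (q).
rewrite (@series_mul_supp1 _ _ _ _ _ _ (pI a' t') (Node k' n' gs' l)); last first.
  move=> p q pq; rewrite mulf_eq0 negb_or => /andP[/AE[v e] _]; move: pq; rewrite e.
  by case: (q) => k2 n2 gs2 bs2 /=; rewrite mi_0add => -[-> -> -> -> -> ->].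
rewrite /= mi_0add eqxx /B IH //; last by move=> b u bb; apply: HM; rewrite inE bb orbT.
rewrite eqseq_cons xpair_eqE.
have [->|aa'] := eqVneq a' a; last first.
  rewrite /= !andbF; have [->|/AE[v [e]]] := eqVneq (A (pI a' t')) 0; first by rewrite mul0r.
  by rewrite e eqxx in aa'.
rewrite /A series_map_supp1; last exact: pI_inj.
rewrite (HM (a, t) t') ?mem_head //=.
have [e|ne] := eqVneq (strip t') t; last by rewrite if_same mul0r !andbF.
rewrite mem_set; last by apply: plantable_strip; rewrite e; exact: in_TX_plantable.
rewrite /= natrM invfM; by case: ifP => //; rewrite mulr0.
Qed.

(** Planar representatives keep the order of the branches, so [u] occurs in the
localisation of [t] exactly when erasing its polynomials gives [t] itself, and
then with coefficient the product of the [1 / k!].  The restriction to plantable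
trees is harmless since a stripped tree other than 1 stays plantable when
decorated. *)
Lemma Mloc_strip (R : realType) d (t u : ptree d) :
  planted (pbranches t) -> no_poly t ->
  Mloc R t u = if strip u == t then (decfact u)%:R^-1 else 0.
Proof.
elim/ptree_ind_in: t u => k n gs bs IH [k' n' gs' bs'] /= plbs /andP[/eqP -> np].
have {IH} MB b v : b \in bs ->
    Mloc R b.2 v = if strip v == b.2 then (decfact v)%:R^-1 else 0.
  move=> bbs; apply: IH => //; last exact: (allP np).
  have := allP plbs b bbs => /andP[_]; case: (b.2) => k3 n3 gs3 bs3.
  by move=> /and3P[].
set A := fun u => \sum_(k \in _) _.
have AX k1 : A (pX k1) = (mi_fact k1)%:R^-1.
  rewrite /A (@fsum_supp1 _ _ _ k1) ?mem_set // => [|k2 _ k21].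
    by rewrite /monomial eqxx mulr1.
  by rewrite /monomial; case: eqP => [[e]|]; rewrite ?mulr0 // e eqxx in k21 *.
have AE v : A v != 0 -> exists k1, v = pX k1.
  apply: contraPP => nv; apply/negP; rewrite negbK; apply/eqP; apply: fsbig1 => k1 _.
  rewrite /monomial; case: eqP => [e|]; rewrite ?mulr0 //.
  by case: nv; exists k1.
have BE k2 n2 gs2 bs2 := @Mloc_branches R d n gs bs k2 n2 gs2 bs2 plbs MB.
rewrite (@series_mul_supp1 _ _ _ _ _ _ (pX k') (Node (mi0 d) n' gs' bs')); last first.
  move=> p q pq; rewrite mulf_eq0 negb_or => /andP[/AE[v e]]; move: pq; rewrite e.
  case: (q) => k2 n2 gs2 bs2 /= e2; rewrite BE.
  case: ifP => [/and4P[/eqP k20 _ _ _] _|]; last by rewrite eqxx.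
  by move: e2; rewrite k20 mi_add0 => -[-> -> -> ->].
rewrite /= mi_add0 eqxx AX BE.
rewrite eqxx /=.
have -> : (Node (mi0 d) n' gs' [seq (b.1, strip b.2) | b <- bs'] == Node (mi0 d) n gs bs)
   = [&& n' == n, gs' == gs & [seq (b.1, strip b.2) | b <- bs'] == bs].
  by apply/eqP/and3P => [[-> -> ->]|[/eqP -> /eqP -> /eqP ->]].
by rewrite natrM invfM; case: ifP => // _; rewrite mulr0.
Qed.

(** * The part of root extraction without branches on the right *)

Definition xibar_root d (t : ptree d) : ptree d :=
  let: Node k n gs bs := t in Node k XiBar gs bs.

Lemma series_mul_eq (R : realType) (T : choiceType) (m : T -> T -> T)
    (s1 s2 s1' s2' : T -> R) u :
  (forall p q, m p q = u -> s1 p * s2 q = s1' p * s2' q) ->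
  series_mul m s1 s2 u = series_mul m s1' s2' u.
Proof. by move=> h; apply: eq_fsbigr => -[p q] /set_mem /= /h. Qed.

Lemma series_mul_monomial (R : realType) (T : choiceType) (m : T -> T -> T) (a b u : T) :
  series_mul m (monomial R a) (monomial R b) u = monomial R (m a b) u.
Proof.
rewrite (@series_mul_supp1 _ _ _ _ _ _ a b) /monomial.
  by rewrite !eqxx mulr1 eq_sym; case: eqP.
move=> p q _; rewrite mulf_eq0 negb_or !pnatr_eq0 !eqb0 !negbK.
by move=> /andP[/eqP -> /eqP ->].
Qed.

Lemma series_mul_monomialD (R : realType) (T : choiceType) (m : T -> T -> T) (a a' b u : T) :
  series_mul m (fun p => monomial R a p + monomial R a' p) (monomial R b) u
  = monomial R (m a b) u + monomial R (m a' b) u.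
Proof.
rewrite -!series_mul_monomial -(@fsum_add_supp1 _ _ _ (a, b) (a', b)).
- by apply: eq_fsbigr => -[p q] _ /=; rewrite mulrDl.
- move=> [p q] _ /=; rewrite /monomial xpair_eqE; case: eqP; rewrite ?mul0r //.
  by case: eqP; rewrite ?mulr0.
- move=> [p q] _ /=; rewrite /monomial xpair_eqE; case: eqP; rewrite ?mul0r //.
  by case: eqP; rewrite ?mulr0.
Qed.

Lemma pmul_branches_nil d (t u : ptree d) :
  pbranches (pmul t u) = [::] -> pbranches t = [::] /\ pbranches u = [::].
Proof. by case: t => ? ? ? [|? ?]; case: u => ? ? ? [|? ?]. Qed.

(** A right factor without branches uses no summand with a grey edge, since these
put a branch on the right.  Then every branch is moved whole to the left: an inner
noise that is extracted leaves [Xibar] behind, and the tree containing it cannot be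
planted.  Only the noise at the root has a choice. *)
Lemma Delta_branchless (R : realType) d (t s u : ptree d) :
  planted (pbranches t) -> pbranches u = [::] ->
  Delta R t (s, u) = monomial R (t, pone d) (s, u)
    + (if pnoise t is Xi then monomial R (xibar_root t, pXi d) (s, u) else 0).
Proof.
elim/ptree_ind_in: t s u => k n gs bs IH s u /= plbs u0.
(* On right factors without branches, a branch contributes itself. *)
have {IH} DB (b : mi d * ptree d) p : b \in bs -> pbranches p.2 = [::] ->
    Delta_branch b.1 b.2 (Delta R b.2) p = monomial R (pI b.1 b.2, pone d) p.
  case: b => a t; case: p => v w bbs /= w0; rewrite /Delta_branch /=.
  have := allP plbs (a, t) bbs => /= /andP[t1 tT].
  rewrite [X in _ + X]fsbig1 ?addr0; last first.
    move=> c _; rewrite /monomial; case: eqP; rewrite ?mulr0 // => -[_ e].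
    by rewrite e in w0.
  have h_inj : injective (fun p' : ptree d * ptree d => (pI a p'.1, p'.2)).
    by move=> [x y] [x' y'] /= [-> ->].
  have [[v' ->]|nv] := pselect (exists v', v = pI a v'); last first.
    rewrite /monomial; have -> : ((v, w) == (pI a t, pone d)) = false.
      by apply/eqP => -[e _]; apply: nv; exists t.
    apply/eqP; apply: contra_notT nv => /series_map_neq0[[v' w'] [e _]].
    by exists v'.
  rewrite (series_map_supp1 _ _ (v', w) h_inj).
  have -> : monomial R (pI a t, pone d) (pI a v', w) = monomial R (t, pone d) (v', w).
    rewrite /monomial !xpair_eqE; congr (_ && _)%:R.
    by apply/eqP/eqP => [/pI_inj|->].
  case: ifPn => [/set_mem /= pl|npl].
    rewrite (IH (a, t)) //=; last by case: (t) tT => ? ? ? ? /and3P[].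
    have nX : ((v', w) == (xibar_root t, pXi d)) = false.
      apply/eqP => -[e _]; move: pl; rewrite e /plantable andbC.
      by case: (t) => ? ? ? ? /=; rewrite eqxx.
    by case: (pnoise t); rewrite /monomial ?nX addr0.
  rewrite /monomial; case: eqP => // -[e _]; move: npl; rewrite mem_set //= e.
  exact: in_TX_plantable.
(* The same for the product of all branches. *)
have {DB} DBs s' u' : pbranches u' = [::] ->
   foldr (fun b s => series_mul (@pmul2 d) (Delta_branch b.1 b.2 (Delta R b.2)) s)
     (monomial R (pone d, pone d)) bs (s', u')
   = monomial R (Node (mi0 d) NoNoise [::] bs, pone d) (s', u').
  elim: bs plbs DB s' u' => [//|b bs IHb] /= /andP[_ plbs] DB s' u' u'0.
  have -> : (Node (mi0 d) NoNoise [::] (b :: bs), pone d)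
      = pmul2 (pI b.1 b.2, pone d) (Node (mi0 d) NoNoise [::] bs, pone d).
    by rewrite /pmul2 /= mi_add0; case: (b).
  rewrite -series_mul_monomial.
  apply: series_mul_eq => -[p1 p2] [q1 q2] [_ e].
  have [p20 q20] : pbranches p2 = [::] /\ pbranches q2 = [::].
    by apply: pmul_branches_nil; rewrite e.
  rewrite DB ?mem_head //= IHb //.
  by move=> c p cbs; apply: DB; rewrite inE cbs orbT.
transitivity (series_mul (@pmul2 d) (@Delta_noise R d k n gs)
   (monomial R (Node (mi0 d) NoNoise [::] bs, pone d)) (s, u)).
  apply: series_mul_eq => -[p1 p2] [q1 q2] [_ e].
  by rewrite DBs //; have [] : pbranches p2 = [::] /\ pbranches q2 = [::]
    by apply: pmul_branches_nil; rewrite e.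
have mulE m w : pmul2 (Node k m gs [::], w) (Node (mi0 d) NoNoise [::] bs, pone d)
   = (Node k m gs bs, pmul w (pone d)).
  by rewrite /pmul2 /= mi_add0 cats0; case: m.
have mul1 : pmul (pone d) (pone d) = pone d by rewrite /= mi_add0.
have mulX : pmul (pXi d) (pone d) = pXi d by rewrite /= mi_add0.
case: n => /=; rewrite ?addr0.
- by rewrite series_mul_monomial mulE mul1.
- by rewrite series_mul_monomialD !mulE mul1 mulX addrC.
- by rewrite series_mul_monomial mulE mul1.
Qed.

Lemma Mloc_Delta_branchless (R : realType) d (t s u : ptree d) :
  planted (pbranches t) -> pbranches u = [::] ->
  Mloc_Delta R t (s, u) = (u == pone d)%:R * Mloc R t s
    + (if pnoise t is Xi then (u == pXi d)%:R * Mloc R (xibar_root t) s else 0).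
Proof.
move=> plt u0; rewrite /Mloc_Delta /=.
transitivity (\sum_(v \in setT)
  ((v == t)%:R * ((u == pone d)%:R * Mloc R t s)
   + (v == xibar_root t)%:R * (if pnoise t is Xi then
       (u == pXi d)%:R * Mloc R (xibar_root t) s else 0))).
  apply: eq_fsbigr => v _; rewrite Delta_branchless // /monomial !xpair_eqE.
  rewrite mulrDl; congr (_ + _).
    by case: eqP => [->|]; case: eqP => /=; rewrite ?mul1r ?mul0r.
  by case: (pnoise t); rewrite ?mul0r ?mulr0 //; case: eqP => [->|];
    case: eqP => /=; rewrite ?mul1r ?mul0r.
rewrite (@fsum_add_supp1 _ _ _ t (xibar_root t)).
- rewrite (@fsum_supp1 _ _ _ t); last by move=> v _ /negPf ->; rewrite mul0r.
  rewrite (@fsum_supp1 _ _ _ (xibar_root t)); last by move=> v _ /negPf ->; rewrite mul0r.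
  by rewrite !mem_set // !eqxx !mul1r.
- by move=> v _ /negPf ->; rewrite mul0r.
- by move=> v _ /negPf ->; rewrite mul0r.
Qed.

(** * Derivatives on the jet space *)

Section schwarz.
Variable R : realType.

Lemma mvt_increment (u du : R -> R) (h : R) : 0 < h ->
  (forall x : R, is_derive x 1 u (du x)) ->
  exists2 c, 0 < c < h & u h - u 0 = du c * h.
Proof.
move=> h0 ud; have cu : {within `[0, h], continuous u}.
  apply: continuous_subspaceT => x; apply: differentiable_continuous.
  by apply/derivable1_diffP; have [] := ud x.
have [c] := MVT h0 (fun x _ => ud x) cu.
by rewrite in_itv /= subr0 => ch e; exists c.
Qed.

(** The mean value theorem in the first variable, then in the second. *)
Lemma mixed_increment (H Hx Hxy : R -> R -> R) (h : R) : 0 < h ->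
  (forall x y : R, is_derive x 1 (H ^~ y) (Hx x y)) ->
  (forall x y : R, is_derive y 1 (Hx x) (Hxy x y)) ->
  exists x y, [/\ 0 < x < h, 0 < y < h &
    H h h - H h 0 - (H 0 h - H 0 0) = Hxy x y * h * h].
Proof.
move=> h0 dH dHx.
have dB (x : R) : is_derive x 1 (fun x : R => H x h - H x 0) (Hx x h - Hx x 0).
  by apply: is_deriveB; exact: dH.
have [x xh e] := mvt_increment h0 dB.
have [y yh e'] := @mvt_increment (Hx x) (Hxy x) h h0 (dHx x).
by exists x, y; split => //; rewrite e e'.
Qed.

(** Symmetry of mixed derivatives: the double increment over a square of side [h]
is [h^2] times a value of either mixed derivative near the corner. *)
Lemma schwarz (H Hx Hy Hxy Hyx : R -> R -> R) :
  (forall x y : R, is_derive x 1 (H ^~ y) (Hx x y)) ->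
  (forall x y : R, is_derive y 1 (H x) (Hy x y)) ->
  (forall x y : R, is_derive y 1 (Hx x) (Hxy x y)) ->
  (forall x y : R, is_derive x 1 (Hy ^~ y) (Hyx x y)) ->
  (forall e, 0 < e -> exists2 r, 0 < r & forall x y, `|x| < r -> `|y| < r ->
     `|Hxy x y - Hxy 0 0| < e) ->
  (forall e, 0 < e -> exists2 r, 0 < r & forall x y, `|x| < r -> `|y| < r ->
     `|Hyx x y - Hyx 0 0| < e) ->
  Hxy 0 0 = Hyx 0 0.
Proof.
move=> dHx dHy dHxy dHyx cxy cyx; apply/eqP; rewrite -subr_eq0 -normr_le0.
apply/ler_addgt0Pr => e e0; rewrite add0r.
have e20 : 0 < e / 2 by lra.
have [r r0 hr] := cxy _ e20; have [r' r'0 hr'] := cyx _ e20.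
pose h := Num.min r r'; have h0 : 0 < h by rewrite lt_min r0.
have [x [y [xh yh exy]]] := mixed_increment h0 dHx dHxy.
have [y' [x' [y'h x'h eyx]]] :=
  @mixed_increment (fun y x => H x y) (fun y x => Hy x y) (fun y x => Hyx x y) h h0
     (fun y x => dHy x y) (fun y x => dHyx x y).
have hrr : h <= r /\ h <= r' by split; rewrite ge_min lexx ?orbT.
have nrm z : 0 < z < h -> `|z| < r /\ `|z| < r'.
  by move=> /andP[z0 zh]; rewrite gtr0_norm //; split; lra.
have [[x1 x2] [y1 y2]] := (nrm _ xh, nrm _ yh).
have [[x'1 x'2] [y'1 y'2]] := (nrm _ x'h, nrm _ y'h).
have := hr x y x1 y1; have := hr' x' y' x'2 y'2.
have -> : Hxy x y = Hyx x' y'.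
  have hh : h * h != 0 by rewrite mulf_neq0 // gt_eqF.
  apply: (mulIf hh); rewrite !mulrA -exy -eyx; ring.
rewrite !ltr_norml => /andP[? ?] /andP[? ?].
by rewrite ler_norml; apply/andP; split; lra.
Qed.

End schwarz.

Lemma iter_dir_mi0 d (V : Type) (op : 'I_d.+1 -> V -> V) F : iter_dir op (mi0 d) F = F.
Proof. by rewrite /iter_dir; elim: (enum _) => //= i s ->; rewrite ffunE. Qed.

Section jet_derivatives.
Variables (R : realType) (d : nat).
Implicit Types (F : jetfun R d) (Z : mi d -> R) (a b : mi d).

Lemma jet_shiftD Z a (h h' : R) : jet_shift (jet_shift Z a h) a h' = jet_shift Z a (h' + h).
Proof. by apply/funext => b; rewrite /jet_shift mulrDl addrAC addrA. Qed.

Lemma jet_shiftC Z a b (h h' : R) :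
  jet_shift (jet_shift Z a h) b h' = jet_shift (jet_shift Z b h') a h.
Proof. by apply/funext => c; rewrite /jet_shift addrAC. Qed.

Lemma jet_shift0 Z a : jet_shift Z a (0 : R) = Z.
Proof. by apply/funext => b; rewrite /jet_shift mul0r addr0. Qed.

(** [DZ] is defined through derivatives at the origin of the shift parameter; by
translation of the base point they are derivatives everywhere. *)
Lemma is_derive_jet F Z a (x : R) :
  (forall Z, derivable (fun h : R => F (jet_shift Z a h)) 0 1) ->
  is_derive x 1 (fun h : R => F (jet_shift Z a h)) (DZ a F (jet_shift Z a x)).
Proof.
move=> dF; have := dF (jet_shift Z a x).
have e : (fun h : R => h^-1 *: (((fun h : R => F (jet_shift Z a h)) \o shift x) (h *: 1)
    - F (jet_shift Z a x))) =
  (fun h : R => h^-1 *: (((fun h : R => F (jet_shift (jet_shift Z a x) a h)) \o shift 0)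
    (h *: 1) - F (jet_shift (jet_shift Z a x) a 0))).
  by apply/funext => h /=; rewrite !jet_shiftD addr0 add0r.
move=> dx; apply: DeriveDef; first by rewrite /derivable e.
by rewrite /DZ derive1E /derive e.
Qed.

Lemma Ds_cat s s' F : Ds (s ++ s') F = Ds s (Ds s' F).
Proof. exact: foldr_cat. Qed.

Lemma jet_smooth_Ds s F : jet_smooth F -> jet_smooth (Ds s F).
Proof. by move=> sF s'; have := sF (s' ++ s); rewrite Ds_cat. Qed.

(** Continuity on the jet space only constrains finitely many coordinates, and a
shift in two directions moves each coordinate by at most the sum of the two shifts. *)
Lemma DZC a b F : jet_smooth F -> DZ a (DZ b F) = DZ b (DZ a F).
Proof.
move=> sF; apply/funext => Z.
have der s c Z' x := @is_derive_jet (Ds s F) Z' c x (fun Z => (sF s).2 Z c).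
pose P x y := jet_shift (jet_shift Z a x) b y.
have P00 : P 0 0 = Z by rewrite /P !jet_shift0.
have cont s e : 0 < e -> exists2 r : R, 0 < r & forall x y, `|x| < r -> `|y| < r ->
    `|Ds s F (P x y) - Ds s F (P 0 0)| < e.
  move=> e0; have [s' [r [r0 hr]]] := (sF s).1 (P 0 0) e e0.
  exists (r / 2) => [|x y xr yr]; first by lra.
  apply: hr => c _; rewrite /P /jet_shift.
  have nb (z : R) (t : bool) : `|z * t%:R| <= `|z|.
    by case: t; rewrite ?mulr1 ?mulr0 ?normr0.
  rewrite !mul0r !addr0.
  have := ler_normD (x * (c == a)%:R) (y * (c == b)%:R).
  have := nb x (c == a); have := nb y (c == b).
  rewrite (_ : Z c + x * (c == a)%:R + y * (c == b)%:R - Z c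
    = x * (c == a)%:R + y * (c == b)%:R); last by ring.
  lra.
rewrite -P00.
apply/esym; apply: (@schwarz R (fun x y => F (P x y)) (fun x y => DZ a F (P x y))
  (fun x y => DZ b F (P x y)) (fun x y => DZ b (DZ a F) (P x y))
  (fun x y => DZ a (DZ b F) (P x y))).
- move=> x y; rewrite /P (_ : (fun x => _) = fun h => F (jet_shift (jet_shift Z b y) a h)).
    by rewrite jet_shiftC; exact: (der [::]).
  by apply/funext => h; rewrite jet_shiftC.
- by move=> x y; exact: (der [::]).
- by move=> x y; exact: (der [:: a]).
- move=> x y; rewrite /P (_ : (fun x => _) = fun h => DZ b F (jet_shift (jet_shift Z b y) a h)).
    by rewrite jet_shiftC; exact: (der [:: b]).
  by apply/funext => h; rewrite jet_shiftC.
- exact: (cont [:: b; a]).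
- exact: (cont [:: a; b]).
Qed.

Lemma Ds_perm F (s s' : seq (mi d)) : jet_smooth F -> perm_eq s s' -> Ds s F = Ds s' F.
Proof.
move=> sF; elim: s s' => [|a s IH] s'; first by move=> /perm_size/esym/size0nil ->.
move=> e; have /splitPr as' : a \in s' by rewrite -(perm_mem e) mem_head.
case: as' e => s1 s2; rewrite perm_sym -cat1s perm_catCA /= perm_cons perm_sym => /IH /= ->.
elim: s1 => //= c s1 <-; apply: DZC; exact: jet_smooth_Ds.
Qed.

Lemma DZ0 a : DZ a (fun=> 0 : R) = fun=> 0.
Proof. by apply/funext => Z; exact: derive1_cst. Qed.

Lemma Ds0 (s : seq (mi d)) : Ds s (fun=> 0 : R) = fun=> 0.
Proof. by elim: s => //= a s ->; exact: DZ0. Qed.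

Lemma iter_dir_dZ0 (k : mi d) : iter_dir (@dZ R d) k (fun=> 0) = fun=> 0.
Proof.
rewrite /iter_dir; elim: (enum _) => //= i s ->; elim: (k i) => //= n ->.
by apply/funext => Z; apply: fsbig1 => a _; rewrite DZ0 mulr0.
Qed.

Lemma depends_upto_DZ n F a : depends_upto n F -> depends_upto n (DZ a F).
Proof.
move=> dF Z Z' ZZ'; rewrite /DZ; congr derive1; apply/funext => h.
by apply: dF => b b0 bn; rewrite /jet_shift ZZ'.
Qed.

Lemma depends_upto_DZ0 n F a : depends_upto n F ->
  ~~ ((a ord0 == 0%N) && (sdeg a <= n)%N) -> DZ a F = fun=> 0.
Proof.
move=> dF na; apply/funext => Z; rewrite /DZ.
rewrite (_ : (fun h => _) = cst (F Z)); first exact: derive1_cst.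
apply/funext => h; apply: dF => b b0 bn; rewrite /jet_shift.
case: eqP => [e|]; last by rewrite mulr0 addr0.
by move: na; rewrite -e b0 bn.
Qed.

(** Differentiating in a variable that does not occur gives zero, so the derivatives
that do not vanish only involve the finitely many admissible labels. *)
Lemma depends_upto_Ds n F s : depends_upto n F -> Ds s F <> (fun=> 0) ->
  all (fun a : mi d => (a ord0 == 0%N) && (sdeg a <= n)%N) s.
Proof.
move=> dF; have dDs s' : depends_upto n (Ds s' F).
  by elim: s' => //= a s'; exact: depends_upto_DZ.
elim: s => //= a s IH ne; apply/andP; split.
  by apply: contra_notT ne; exact: depends_upto_DZ0.
by apply: IH => e; apply: ne; rewrite e; exact: DZ0.
Qed.

(** The order of the branches is the order of the derivatives. *)
Lemma pUps_iso (g f : jetfun R d) (t u : ptree d) : jet_smooth g -> jet_smooth f ->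
  tree_iso t u -> pUps g f t = pUps g f u.
Proof.
move=> sg sf; move: t u; apply: iso_invariant => [k n gs gs' bs bs' pg pb|k n gs a t u bs tu e].
  apply/funext => Z /=; congr (_ * _).
    congr (iter_dir _ _ _ Z); have sU : jet_smooth (Ups0 g f n) by case: (n).
    rewrite (Ds_perm sU (perm_map _ pg)).
    by apply: (Ds_perm _ (perm_map _ pb)); exact: jet_smooth_Ds.
  by apply: perm_foldr pb => a b y; exact: mulrCA.
by apply/funext => Z /=; rewrite e.
Qed.

End jet_derivatives.

(** * Degrees and subcriticality *)

(** The number of edges plus the scaled degrees of all polynomials: the quantity that
is controlled by the degree. *)
Fixpoint tsize d (t : ptree d) : nat :=
  let: Node k _ _ bs := t in (sdeg k + foldr (fun b m => (tsize b.2).+1 + m) 0 bs)%N.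

Fixpoint labels d (t : ptree d) : seq (mi d) :=
  let: Node _ _ _ bs := t in foldr (fun b l => b.1 :: labels b.2 ++ l) [::] bs.

Section finite_trees.
Variable d : nat.

Fixpoint seqs_upto (T : Type) (n : nat) (l : seq T) : seq (seq T) :=
  if n is m.+1 then [::] :: [seq x :: s | x <- l, s <- seqs_upto m l] else [:: [::]].

Lemma mem_seqs_upto (T : eqType) n (l s : seq T) :
  (size s <= n)%N -> all [in l] s -> s \in seqs_upto n l.
Proof.
elim: n s => [|n IH] [|x s] //= sn /andP[xl sl]; rewrite inE.
by apply/allpairsP; exists (x, s); split => //; exact: IH.
Qed.

Lemma leq_coord_sdeg (k : mi d) i : (k i <= sdeg k)%N.
Proof.
rewrite /sdeg (bigD1 i) //= (leq_trans _ (leq_addr _ _)) // leq_pmull //.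
by case: ifP.
Qed.

Definition mi_upto (N : nat) : seq (mi d) :=
  [seq [ffun i => nat_of_ord (h i)] | h : {ffun 'I_d.+1 -> 'I_N.+1}].

Lemma mem_mi_upto N (k : mi d) : (sdeg k <= N)%N -> k \in mi_upto N.
Proof.
move=> kN; apply/mapP; exists [ffun i => inord (k i)]; first by rewrite mem_enum.
apply/ffunP => i; rewrite !ffunE inordK // ltnS.
exact: leq_trans (leq_coord_sdeg k i) kN.
Qed.

Lemma tsizeE k n gs (bs : seq (mi d * ptree d)) :
  tsize (Node k n gs bs) = (sdeg k + \sum_(b <- bs) (tsize b.2).+1)%N.
Proof.
by congr addn; elim: bs => [|b bs IH]; rewrite ?big_nil // big_cons -IH.
Qed.

Lemma leq_sum_mem (T : eqType) (s : seq T) (F : T -> nat) x :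
  x \in s -> (F x <= \sum_(y <- s) F y)%N.
Proof.
elim: s => // y s IH; rewrite inE big_cons => /predU1P[->|/IH]; first exact: leq_addr.
by move=> /leq_trans; apply; exact: leq_addl.
Qed.

(** Induction on the size: the root has a bounded decoration and a bounded number of
branches, which are smaller trees with bounded labels. *)
Lemma finite_trees (m N : nat) : exists s : seq (ptree d), forall t : ptree d,
  in_TX t -> (tsize t < N)%N -> all (fun a => sdeg a <= m)%N (labels t) -> t \in s.
Proof.
elim: N => [|N [s IH]]; first by exists [::].
pose l := [seq (a, t) | a <- mi_upto m, t <- s].
pose nodes n := [seq Node k n [::] bs | k <- mi_upto N, bs <- seqs_upto N l].
exists (nodes NoNoise ++ nodes Xi).
move=> [k n gs bs] /= /and3P[nB /nilP -> bsT].
rewrite -/(tsize (Node k n [::] bs)) tsizeE ltnS => sz lab.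
have szb b : b \in bs -> (tsize b.2 < N)%N.
  move=> /(leq_sum_mem (fun b => (tsize b.2).+1)) /leq_trans; apply.
  exact: leq_trans (leq_addl _ _) sz.
have labb b : b \in bs -> (sdeg b.1 <= m)%N && all (fun a => sdeg a <= m)%N (labels b.2).
  elim: bs lab {bsT sz szb} => //= c bs IHb /andP[c1]; rewrite all_cat => /andP[c2 /IHb].
  by rewrite inE => + /predU1P[->|?]; [rewrite c1|exact].
suff nodeP : Node k n [::] bs \in nodes n.
  by rewrite mem_cat; case: n nB nodeP => [_ ->|_ ->|]; rewrite ?orbT ?eqxx.
apply/allpairsP; exists (k, bs); split => //=.
  by apply: mem_mi_upto; apply: leq_trans sz; exact: leq_addr.
apply: mem_seqs_upto.
  apply: leq_trans sz; apply: leq_trans (leq_addl _ _).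
  by rewrite -sum1_size; apply: leq_sum.
apply/allP => b bbs; apply/allpairsP; exists b; have /andP[b1 b2] := labb b bbs.
split; [exact: mem_mi_upto| |by case: (b)].
by apply: IH => //; [have /andP[] := allP bsT b bbs|exact: szb].
Qed.

End finite_trees.

Section degrees.
Variables (R : realType) (d : nat) (alpha kappa : R) (g f : jetfun R d).
Let dXi := -2 + alpha - kappa.

Lemma pdegE k n gs (bs : seq (mi d * ptree d)) :
  pdeg alpha kappa (Node k n gs bs) = (if n is Xi then dXi else 0) + (sdeg k)%:R
    + \sum_(b <- bs) (pdeg alpha kappa b.2 + 2 - (sdeg b.1)%:R).
Proof.
by congr (_ + _); elim: bs => [|b bs IH]; rewrite ?big_nil // big_cons -IH.
Qed.

(** [r] plays the role of the regularity of the solution.  It is the exact regularity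
of the noise term when [f] does not vanish, and every node with [size s] branches of
regularity [r] improves on [r] by at least [eta] for each of its branches. *)
Definition gain (r eta : R) :=
  [/\ 0 < eta <= 1, r <= 2, (f <> (fun=> 0) -> r = 2 + dXi) &
  forall s : seq (mi d), s != [::] ->
    (Ds s g <> (fun=> 0) ->
       r + eta * (size s)%:R <= 2 + \sum_(a <- s) (r - (sdeg a)%:R)) /\
    (Ds s f <> (fun=> 0) ->
       r + eta * (size s)%:R <= 2 + dXi + \sum_(a <- s) (r - (sdeg a)%:R))].

(** Subcriticality provides a regularity [regI] and a gain [delta] at every allowed
node.  The node without branches gives [r - regI >= delta].  For a node with
[n >= 1] branches, raising their regularity from [regI] to [r] adds
[n (r - regI)] to the bound [regI + delta], which makes
[r + delta + (n - 1) (r - regI) >= r + n delta]. *)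
Lemma subcritical_gain : alpha <= 1 -> 0 < kappa -> subcritical alpha kappa g f ->
  exists r eta : R, gain r eta.
Proof.
move=> a1 k0 [regI [regXi [delta [hXi d0 hs]]]].
(* The choice eta = min(delta, 1) also makes polynomials count at most with their degree. *)
have key r : regI + delta <= r -> (f <> (fun=> 0) -> r = 2 + dXi) -> r <= 2 ->
    gain r (Num.min delta 1).
  move=> hr fr r2; split => //; first by rewrite ge_min lexx orbT lt_min d0 ltr01.
  move=> s s0; have n1 : 1 <= (size s)%:R :> R by rewrite ler1n lt0n size_eq0.
  have -> : \sum_(a <- s) (r - (sdeg a)%:R)
      = \sum_(a <- s) (regI - (sdeg a)%:R) + (r - regI) * (size s)%:R.
    rewrite -sum1_size natr_sum mulr_sumr -big_split /=; apply: eq_bigr => a _.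
    by rewrite mulr1; ring.
  have md : Num.min delta 1 * (size s)%:R <= delta * (size s)%:R.
    by apply: ler_wpM2r; rewrite ?ge_min ?lexx //; lra.
  have dn : delta * ((size s)%:R - 1) <= (r - regI) * ((size s)%:R - 1).
    by apply: ler_wpM2r; lra.
  have [hg hf] := hs s; split=> [/hg ?|/hf ?]; first lra.
  rewrite /dXi; lra.
have [f0|fn0] := pselect (f = fun=> 0); last first.
  have := (hs [::]).2 fn0; rewrite big_nil addr0 => h0.
  by exists (2 + dXi), (Num.min delta 1); apply: key => //; rewrite /dXi; lra.
have [g0|gn0] := pselect (g = fun=> 0).
  by exists 2, 1; split=> //; [lra|move=> s _; rewrite f0 g0 Ds0].
have := (hs [::]).1 gn0; rewrite big_nil addr0 => h0.
by exists 2, (Num.min delta 1); apply: key => //; lra.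
Qed.

Lemma pUps_neq0 k n gs (bs : seq (mi d * ptree d)) :
  pUps g f (Node k n gs bs) <> (fun=> 0) ->
  Ds [seq b.1 | b <- bs] (Ds [seq b.1 | b <- gs] (Ups0 g f n)) <> (fun=> 0) /\
  forall b, b \in bs -> pUps g f b.2 <> (fun=> 0).
Proof.
move=> U0; split=> [e|b bbs e]; apply: U0; apply/funext => Z /=.
  by rewrite e iter_dir_dZ0 mul0r.
suff -> : foldr (fun b x => pUps g f b.2 Z * x) 1 bs = 0 by rewrite mulr0.
elim: bs bbs => //= c bs IH; rewrite inE => /predU1P[<-|/IH ->]; last by rewrite mulr0.
by rewrite e mul0r.
Qed.

Variables (r eta : R).
Hypothesis gr : gain r eta.

Lemma gain_node n (bs : seq (mi d * ptree d)) : bs != [::] ->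
  Ds [seq b.1 | b <- bs] (Ups0 g f n) <> (fun=> 0) ->
  r + eta * (size bs)%:R <= 2 + (if n is NoNoise then 0 else dXi)
     + \sum_(b <- bs) (r - (sdeg b.1)%:R).
Proof.
move=> bs0; have [_ _ _ /(_ [seq b.1 | b <- bs])[]] := gr.
  by case: (bs) bs0.
by rewrite size_map big_map; case: n => /= hg hf; rewrite ?addr0.
Qed.

(** The excess of the regularity of a branch over [r] is superadditive: a node adds
up the excesses of its branches, its own gain and its polynomial.  Leaves have
nonnegative excess by the choice of [r]. *)
Lemma pdeg_lower_bound (t : ptree d) : in_TX t -> pUps g f t <> (fun=> 0) ->
  r + eta * (tsize t)%:R <= pdeg alpha kappa t + 2.
Proof.
have [/andP[eta0 eta1] r2 fr _] := gr.
elim/ptree_ind_in: t => k n gs bs IH /and3P[nB /nilP -> bsT] /pUps_neq0[U0 Ub].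
rewrite pdegE tsizeE natrD mulrDr.
have ek : eta * (sdeg k)%:R <= (sdeg k)%:R.
  by rewrite -[leRHS]mul1r; apply: ler_wpM2r.
have [bs0|bs0] := eqVneq bs [::].
  subst bs; rewrite !big_nil mulr0 !addr0.
  case: n nB U0 => /= [_ _|_ fn0|/eqP//]; first lra.
  rewrite (fr fn0); lra.
have := gain_node bs0 U0.
have -> : (if n is NoNoise then 0 else dXi) = (if n is Xi then dXi else 0).
  by case: (n) nB; rewrite ?eqxx.
have : eta * (\sum_(b <- bs) (tsize b.2).+1)%:R + \sum_(b <- bs) (r - (sdeg b.1)%:R)
    <= \sum_(b <- bs) (pdeg alpha kappa b.2 + 2 - (sdeg b.1)%:R) + eta * (size bs)%:R.
  rewrite -sum1_size !natr_sum !mulr_sumr -!big_split /= big_seq [leRHS]big_seq.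
  apply: ler_sum => b bbs.
  have /andP[_ bT] := allP bsT b bbs.
  have := IH b bbs bT (Ub b bbs); rewrite -[(tsize b.2).+1%:R]natr1 mulrDr mulr1; lra.
set A := (\sum_(b <- bs) _)%:R; set B := \sum_(b <- bs) (r - _).
set C := \sum_(b <- bs) _; set D := if _ is Xi then _ else _.
by set E := (sdeg k)%:R in ek *; set F := (size bs)%:R; lra.
Qed.

(** This is [gain_node] with the branches at their lower bounds.  For a node with
noise the left-hand side is zero as soon as [f] does not vanish identically. *)
Lemma sum_branches_ge n (bs : seq (mi d * ptree d)) : bs != [::] ->
  all (fun b => in_TX b.2) bs -> (forall b, b \in bs -> pUps g f b.2 <> (fun=> 0)) ->
  Ds [seq b.1 | b <- bs] (Ups0 g f n) <> (fun=> 0) ->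
  r - 2 - (if n is NoNoise then 0 else dXi)
    < \sum_(b <- bs) (pdeg alpha kappa b.2 + 2 - (sdeg b.1)%:R).
Proof.
move=> bs0 bsT Ub U0; have [/andP[eta0 eta1] r2 fr _] := gr.
have sb : \sum_(b <- bs) (r - (sdeg b.1)%:R)
    <= \sum_(b <- bs) (pdeg alpha kappa b.2 + 2 - (sdeg b.1)%:R).
  rewrite big_seq [leRHS]big_seq; apply: ler_sum => b bbs.
  have := pdeg_lower_bound (allP bsT b bbs) (Ub b bbs).
  have : 0 <= eta * (tsize b.2)%:R by rewrite mulr_ge0 // ltW.
  lra.
have := gain_node bs0 U0.
have : 0 < eta * (size bs)%:R by rewrite mulr_gt0 // ltr0n lt0n size_eq0.
by set D := if _ is NoNoise then _ else _; lra.
Qed.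

(** Stripping leaves the class of trees exactly when a leaf [X^k] with [k <> 0]
stands below a branch.  That leaf has positive degree, and positivity is passed on
towards the root: with all branches of regularity [r] the gain makes the degree of a
node larger than [r - 2], and exchanging one of them for a branch of regularity above
[2] adds more than [2 - r]. *)
Lemma pdeg_bare_leaf (t : ptree d) : in_TX t -> ~~ in_TX (strip t) ->
  pUps g f t <> (fun=> 0) -> 0 < pdeg alpha kappa t.
Proof.
have [/andP[eta0 eta1] r2 fr _] := gr.
elim/ptree_ind_in: t => k n gs bs IH /and3P[nB /nilP -> bsT] nS /pUps_neq0[U0 Ub].
have /hasP[b bbs nb] : has (predC (fun b => (strip b.2 != pone d) && in_TX (strip b.2))) bs.
  by rewrite has_predC; move: nS; rewrite /= nB /= all_map.
have /andP[b1 bT] := allP bsT b bbs.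
have db : 0 < pdeg alpha kappa b.2.
  move: nb; rewrite /= negb_and negbK => /orP[/eqP e|nT]; last by apply: IH => //; exact: Ub.
  case: (b.2) e b1 bT => k2 n2 gs2 bs2 /= [-> ->]; case: bs2 => // _ b1 _.
  rewrite add0r addr0 ltr0n lt0n; apply: contra b1 => /eqP k20.
  have -> : k2 = mi0 d.
    apply/ffunP => i; rewrite ffunE; apply/eqP; rewrite -leqn0 -k20.
    exact: leq_coord_sdeg.
  by apply/eqP.
rewrite pdegE.
have bs0 : bs != [::] by case: (bs) bbs.
have := gain_node bs0 U0.
have -> : (if n is NoNoise then 0 else dXi) = (if n is Xi then dXi else 0).
  by case: (n) nB; rewrite ?eqxx.
have : 0 < eta * (size bs)%:R by rewrite mulr_gt0 // ltr0n lt0n size_eq0.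
have : 0 <= (sdeg k)%:R :> R by [].
suff : \sum_(b <- bs) (r - (sdeg b.1)%:R) + (2 - r)
    < \sum_(b <- bs) (pdeg alpha kappa b.2 + 2 - (sdeg b.1)%:R).
  by set D := if _ is Xi then _ else _; lra.
have ge c : c \in bs -> r - (sdeg c.1)%:R <= pdeg alpha kappa c.2 + 2 - (sdeg c.1)%:R.
  move=> cbs; have /andP[_ cT] := allP bsT c cbs.
  have := pdeg_lower_bound cT (Ub c cbs).
  have : 0 <= eta * (tsize c.2)%:R by rewrite mulr_ge0 // ltW.
  lra.
rewrite !(big_rem b bbs) /=.
have : \sum_(c <- rem b bs) (r - (sdeg c.1)%:R)
    <= \sum_(c <- rem b bs) (pdeg alpha kappa c.2 + 2 - (sdeg c.1)%:R).
  rewrite big_seq [leRHS]big_seq; apply: ler_sum => c cbs.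
  by apply: ge; exact: mem_rem cbs.
lra.
Qed.

Lemma labels_bound (m : nat) (t : ptree d) : depends_upto m g -> depends_upto m f ->
  in_TX t -> pUps g f t <> (fun=> 0) -> all (fun a => sdeg a <= m)%N (labels t).
Proof.
move=> dg df; elim/ptree_ind_in: t => k n gs bs IH /and3P[nB /nilP -> bsT] /pUps_neq0[U0 Ub] /=.
have : all (fun a : mi d => sdeg a <= m)%N [seq b.1 | b <- bs].
  have dU : depends_upto m (Ups0 g f n) by case: (n).
  by apply: sub_all (depends_upto_Ds dU U0) => a /andP[].
rewrite all_map => /allP ab; apply/allP => a.
have {}IH b : b \in bs -> all (fun a => sdeg a <= m)%N (labels b.2).
  by move=> bbs; apply: IH; [|have /andP[] := allP bsT b bbs|exact: Ub].
elim: bs ab IH {bsT U0 Ub} => //= b bs IHb ab IH; rewrite inE mem_cat => /or3P[/eqP ->|ab2|].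
- exact: (ab b (mem_head _ _)).
- exact: (allP (IH b (mem_head _ _))).
- by apply: IHb => c cbs; [apply: ab|apply: IH]; rewrite inE cbs orbT.
Qed.

Lemma finite_nonpos_trees (m : nat) : depends_upto m g -> depends_upto m f ->
  finite_set [set t : ptree d |
    [/\ in_TX t, pUps g f t <> (fun=> 0) & pdeg alpha kappa t <= 0]].
Proof.
move=> dg df; have [/andP[eta0 _] _ _ _] := gr.
pose N := Num.truncn ((2 - r) / eta).
have [s hs] := finite_trees d m N.+1.
apply: (@sub_finite_set _ _ [set` s]); last exact: finite_seq.
move=> t [tT U0 t0] /=; apply: hs => //; last exact: labels_bound.
rewrite ltnS -(ler_nat R); have := pdeg_lower_bound tT U0.
move=> lb; have le : (tsize t)%:R <= (2 - r) / eta.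
  by rewrite ler_pdivlMr // mulrC; lra.
by rewrite ler_nat truncn_ge_nat // (le_trans _ le).
Qed.

End degrees.

(** * The model at scale zero *)

Lemma fsum_seq (R : numDomainType) (T : choiceType) (A : set T) (r : seq T) (f : T -> R) :
  uniq r -> (forall i, i \in r -> A i) -> (forall i, A i -> i \notin r -> f i = 0) ->
  \sum_(i \in A) f i = \sum_(i <- r) f i.
Proof.
move=> ur rA f0; rewrite (@fsbigE _ _ _ _ A r) //.
rewrite big_mkcond; apply: eq_big_seq => i /rA Ai; by rewrite mem_set.
Qed.

Section PiX_at_scale_zero.
Variables (R : realType) (d : nat).
Variables (chi : R -> R) (G xi : stpoint R d -> R).

Lemma slab_int0 : slab_int (fun _ : stpoint R d => 0) = 0.
Proof. by rewrite /slab_int /Rintegral integral0. Qed.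

Lemma partial0 i : partial i (fun _ : stpoint R d => 0) = fun=> 0.
Proof. by apply/funext => z; exact: derive_cst. Qed.

Lemma dmi0 (a : mi d) : dmi a (fun _ : stpoint R d => 0) = fun=> 0.
Proof.
by rewrite /dmi /iter_dir; elim: (enum _) => //= i s ->; elim: (a i) => //= n ->; exact: partial0.
Qed.

(** The kernel of every branch is [G - G_0 = 0]. *)
Lemma PiX_step_branches Pi t phi z :
  PiX_step chi G xi 0 Pi t phi z
  = if pbranches t is [::] then (if pnoise t is Xi then xi z else 1) else 0.
Proof.
rewrite /PiX_step; case: (pbranches t) => [|b bs]; first by rewrite big_nil mulr1.
have K0 : (fun w => G w - Gmu chi G 0 w) = fun=> 0.
  by apply/funext => w; rewrite /Gmu eqxx subrr.
rewrite big_cons K0 (_ : Defs.conv _ _ = fun=> 0) ?dmi0 ?mul0r ?mulr0 //.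
apply/funext => w; rewrite /Defs.conv -[RHS]slab_int0; congr slab_int.
by apply/funext => v; rewrite mul0r.
Qed.

Variables (g f : jetfun R d) (ell : seq (tree d) -> R).

(** [S] contains the supports of both sums, which turns the formal sum over pairs of
trees into a finite one. *)
Lemma pPiR_scale_zero n (t : ptree d) (S : seq (ptree d)) phi z :
  uniq S -> planted (pbranches t) ->
  (forall u, u \notin S -> Mloc R t u * ellUps g f ell u phi z = 0) ->
  (forall u, u \notin S -> Mloc R (xibar_root t) u * ellUps g f ell u phi z = 0) ->
  pPiR g f ell chi G xi 0 n t phi z =
  \sum_(u <- S) Mloc R t u * ellUps g f ell u phi z
  + (if pnoise t is Xi then
       (\sum_(u <- S) Mloc R (xibar_root t) u * ellUps g f ell u phi z) * xi z else 0).
Proof.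
move=> uS plt S1 S2; set E := fun u => ellUps g f ell u phi z.
have [Pi ->] : exists Pi, pPiR g f ell chi G xi 0 n t phi z =
    \sum_(p \in [set: ptree d * ptree d])
      Mloc_Delta R t p * E p.1 * PiX_step chi G xi 0 Pi p.2 phi z.
  by case: n => [|n]; [exists (fun _ _ _ => 0)|exists (pPiR g f ell chi G xi 0 n)].
have n1X : (pone d == pXi d) = false by apply/eqP.
transitivity (\sum_(p \in [set: ptree d * ptree d])
    ((p.2 == pone d)%:R * (Mloc R t p.1 * E p.1)
     + (if pnoise t is Xi then (p.2 == pXi d)%:R * (Mloc R (xibar_root t) p.1 * E p.1)
         * xi z else 0))).
  apply: eq_fsbigr => -[u v] _; rewrite PiX_step_branches /=.
  case ev: (pbranches v) => [|b bs].
    rewrite Mloc_Delta_branchless //.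
    have [->|v1] := eqVneq v (pone d).
      by rewrite n1X; case: (pnoise t) => /=; ring.
    by have [->|vX] := eqVneq v (pXi d); case: (pnoise t) => /=; ring.
  have [v1|_] := eqVneq v (pone d); first by rewrite v1 in ev.
  have [vX|_] := eqVneq v (pXi d); first by rewrite vX in ev.
  by case: (pnoise t) => /=; ring.
rewrite (@fsum_seq _ _ _ [seq (u, v) | u <- S, v <- [:: pone d; pXi d]]).
- rewrite big_allpairs_dep /=.
  under eq_bigr do rewrite !big_cons big_nil addr0 /= !eqxx [pXi d == pone d]eq_sym n1X.
  case: (pnoise t) => /=.
  + by rewrite addr0; apply: eq_bigr => u _; rewrite /E; ring.
  + by rewrite mulr_suml -big_split /=; apply: eq_bigr => u _; rewrite /E; ring.
  + by rewrite addr0; apply: eq_bigr => u _; rewrite /E; ring.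
- apply: allpairs_uniq => //; last by move=> [? ?] [? ?] _ _ [-> ->].
  by rewrite /= inE n1X.
- by [].
- move=> [u v] _ uv /=.
  have [v1|v1] := eqVneq v (pone d).
    rewrite v1 n1X S1; last first.
      apply: contra uv => uS'; apply/allpairsP; exists (u, v); split => //=.
      by rewrite v1 inE eqxx.
    by case: (pnoise t) => /=; ring.
  have [vX|vX] := eqVneq v (pXi d); last by case: (pnoise t) => /=; ring.
  rewrite S2; last first.
    apply: contra uv => uS'; apply/allpairsP; exists (u, v); split => //=.
    by rewrite vX !inE eqxx orbT.
  by case: (pnoise t) => /=; ring.
Qed.

End PiX_at_scale_zero.

(** * Contributing trees *)

Lemma in_TX_of_strip d (u : ptree d) : in_TX (strip u) -> in_TX u.
Proof.
elim/ptree_ind_in: u => k n gs bs IH /= /and3P[-> -> bsT] /=.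
apply/allP => b bbs; have := allP bsT (b.1, strip b.2) (map_f _ bbs).
move=> /andP[/= b1 /IH -> //]; rewrite andbT; apply: contra b1 => /eqP ->.
by apply/eqP.
Qed.

Lemma no_poly_strip d (u : ptree d) : no_poly (strip u).
Proof.
elim/ptree_ind_in: u => k n gs bs IH /=; rewrite eqxx all_map.
by apply/allP => b /IH.
Qed.

Lemma down_in_TX d (u : ptree d) : in_TX u -> Defs.down u = u.
Proof.
elim/ptree_ind_in: u => k n gs bs IH /= /and3P[nB /nilP -> bsT].
congr Node; first by case: n nB; rewrite ?eqxx.
rewrite -[RHS]map_id; apply/eq_in_map => -[a t] bbs /=.
by rewrite (IH (a, t)) //; have /andP[] := allP bsT _ bbs.
Qed.

Lemma planted_in_TX d (t : ptree d) : in_TX t -> planted (pbranches t).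
Proof. by case: t => k n gs bs /and3P[]. Qed.

Definition pXiBar d : ptree d := Node (mi0 d) XiBar [::] [::].

Section contributing_trees.
Variables (R : realType) (d : nat) (alpha kappa : R) (g f : jetfun R d).
Variables (ell : seq (tree d) -> R) (r eta : R).
Hypothesis gr : gain alpha kappa g f r eta.
Hypothesis hell : renorm_character alpha kappa ell.

(** These finitely many planar trees contain the supports of both sides of the
expansion. *)
Definition contributing (u : ptree d) :=
  [/\ in_TX u, pUps g f u <> (fun=> 0) & pdeg alpha kappa u <= 0].

Lemma ell_neq0 (u : ptree d) : in_TX u -> ell [:: \pi_(tree d)%qT u] != 0 ->
  u = pone d \/ pdeg alpha kappa u < 0.
Proof.
move=> uT; have [_ _ ell0 _] := hell.
have [->|u1] := eqVneq u (pone d); [by left|right].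
rewrite ltNge; apply: contra_neqN H => u0; apply: ell0.
- by rewrite /treesX /= -(in_TX_iso (repr_iso u)).
- by apply: contra u1 => /pi_isoP /pone_iso ->.
- by rewrite /deg -(pdeg_iso _ _ (repr_iso u)).
Qed.

Lemma ellUps_in_TX (u : ptree d) phi z : in_TX u ->
  ellUps g f ell u phi z = ell [:: \pi_(tree d)%qT u] * pUps g f u (jet phi z).
Proof. by move=> uT; rewrite /ellUps down_in_TX. Qed.

Lemma pUps_neq0_at (u : ptree d) Z : pUps g f u Z != 0 -> pUps g f u <> (fun=> 0).
Proof. by move=> h e; rewrite e eqxx in h. Qed.

Lemma contributing_of_strip (u : ptree d) phi z : in_TX (strip u) ->
  ellUps g f ell u phi z != 0 -> contributing u.
Proof.
move=> /in_TX_of_strip uT; rewrite ellUps_in_TX // mulf_eq0 negb_or => /andP[l0 U0].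
split => //; first exact: pUps_neq0_at U0.
have [->|/ltW//] := ell_neq0 uT l0.
by rewrite /= add0r addr0 sdeg_mi0.
Qed.

(** By [sum_branches_ge] with [f] not identically zero, the branches at the root
have positive total degree.  After removal of [Xibar] the tree therefore has
positive degree, and is killed by [ell], unless it has neither branches nor
polynomial. *)
Lemma xibar_support (u : ptree d) bs phi z : planted bs ->
  strip u = Node (mi0 d) XiBar [::] bs -> ellUps g f ell u phi z != 0 -> u = pXiBar d.
Proof.
case: u => k n gs bs' plbs [-> -> ebs]; rewrite /ellUps mulf_eq0 negb_or => /andP[l0].
move=> /pUps_neq0_at /pUps_neq0[/= U0 Ub].
have bsT : all (fun b => in_TX b.2) bs'.
  apply/allP => b bbs; apply: in_TX_of_strip.
  by have := allP plbs (b.1, strip b.2); rewrite -ebs map_f // => /(_ isT)/andP[].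
have plbs' : planted bs'.
  apply/allP => b bbs; rewrite (allP bsT) // andbT.
  have := allP plbs (b.1, strip b.2); rewrite -ebs map_f // => /(_ isT)/andP[b1 _].
  by apply: contra b1 => /eqP ->; apply/eqP.
have dE : Defs.down (Node k XiBar [::] bs') = Node k NoNoise [::] bs'.
  rewrite /=; congr Node; rewrite -[RHS]map_id; apply/eq_in_map => -[a t] bbs /=.
  by rewrite down_in_TX //; exact: (allP bsT (a, t)).
rewrite dE in l0.
have dT : in_TX (Node k NoNoise [::] bs') by apply/and3P; split => //; apply/eqP.
have := ell_neq0 dT l0; rewrite pdegE add0r => -[[-> ->]//|].
have [->|bs0] := eqVneq bs' [::]; first by rewrite big_nil addr0 ltrn0.
have := sum_branches_ge (n := XiBar) gr bs0 bsT Ub U0.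
have fn0 : f <> (fun=> 0) by move=> f0; apply: U0; rewrite /= f0 Ds0.
have [_ _ /(_ fn0) -> _] := gr.
have : 0 <= (sdeg k)%:R :> R by [].
move=> /= k0; rewrite [2 + _]addrC addrK subrr => s0.
by rewrite ltNge addr_ge0 // ltW.
Qed.

Variables (chi : R -> R) (G xi : stpoint R d -> R).
Variable Gs : seq (ptree d).
Hypotheses (uGs : uniq Gs) (GsP : forall u, u \in Gs <-> contributing u).

(** The last summand comes from the part [Xibar (x) Xi] of the extraction of the
noise at the root. *)
Lemma PiR_scale_zero (tau : tree d) phi z : trees0 tau ->
  PiR g f ell chi G xi 0 tau phi z =
  \sum_(u <- Gs) (if strip u == repr tau then (decfact u)%:R^-1 else 0)
     * (ell [:: \pi_(tree d)%qT u] * pUps g f u (jet phi z))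
  + (if tau == tXi then xi z * f (jet phi z) else 0).
Proof.
rewrite /trees0 /= /PiR => /andP[]; set t := repr tau => tT tn.
have tXiE : (tau == tXi) = (t == pXi d).
  apply/eqP/eqP => [e|e]; first by rewrite /t e repr_tXi.
  by rewrite -[LHS]reprK -/t e.
have plt := planted_in_TX tT.
have MX u : Mloc R (xibar_root t) u
    = if strip u == xibar_root t then (decfact u)%:R^-1 else 0.
  by apply: Mloc_strip; move: plt tn; case: (t).
have GsT u : u \in Gs -> in_TX u by move=> /GsP[].
have noB : pXiBar d \notin Gs.
  by apply/negP => /GsT; rewrite /= eqxx.
have sB : strip (pXiBar d) == t = false.
  by apply/eqP => e; move: tT; rewrite -e /= eqxx.
rewrite (@pPiR_scale_zero _ _ _ _ _ _ _ _ _ _ (pXiBar d :: Gs)) //=; last 3 first.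
- by rewrite noB.
- move=> u; rewrite inE negb_or => /andP[_]; rewrite Mloc_strip //.
  case: eqP => [e uG|]; rewrite ?mul0r //; apply/eqP; rewrite mulf_eq0.
  apply/orP; right; apply: contraNT uG => /contributing_of_strip uG; apply/GsP/uG.
  by rewrite e.
- move=> u; rewrite inE negb_or => /andP[uX _]; rewrite MX.
  case: eqP => [e|]; rewrite ?mul0r //; apply/eqP; rewrite mulf_eq0.
  apply/orP; right; apply: contraNT uX => /(xibar_support plt) -> //.
  by rewrite e; case: (t) tT tn => k n gs bs /= /and3P[_ /nilP -> _] /andP[/eqP ->].
rewrite big_cons Mloc_strip // sB mul0r add0r; congr (_ + _).
  by apply: eq_big_seq => u uG; rewrite Mloc_strip // ellUps_in_TX ?GsT.
rewrite tXiE big_cons big1_seq ?addr0; last first.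
  move=> u /andP[_ /GsT uT]; rewrite MX; case: eqP => [e|]; rewrite ?mul0r //.
  move: uT; case: (u) e => k n gs bs; case: (t) => k' n' gs' bs' [_ -> _ _] /=.
  by rewrite eqxx.
have -> : ellUps g f ell (pXiBar d) phi z = f (jet phi z).
  have [_ l1 _ _] := hell.
  by rewrite /ellUps /= -/(pone d) -/tone l1 iter_dir_mi0 mul1r mulr1.
rewrite MX; have [e|ne] := eqVneq t (pXi d).
  have [-> -> ->] : [/\ pnoise t = Xi, (strip (pXiBar d) == xibar_root t) = true &
      decfact (pXiBar d) = 1%N].
    by rewrite e; split; rewrite //= ?eqxx // mi_fact_mi0.
  by rewrite invr1 mul1r mulrC.
case en : (pnoise t) => //; case: eqP => [e|_]; last by rewrite !mul0r.
case: t en e ne tT {tXiE plt MX sB tn} => k n gs bs /= -> [<- <- <-].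
by rewrite eqxx.
Qed.
End contributing_trees.

(** * The renormalised expansion *)

Lemma sum_partition_seq (V : nmodType) (T C : eqType) (k : T -> C) (s : seq T) (F : T -> V) :
  \sum_(u <- s) F u = \sum_(c <- undup (map k s)) \sum_(u <- s | k u == c) F u.
Proof.
under [RHS]eq_bigr do rewrite big_mkcond.
rewrite exchange_big; apply: eq_big_seq => u us /=.
have ku : k u \in undup (map k s) by rewrite mem_undup map_f.
rewrite (bigD1_seq (k u)) ?undup_uniq //= eqxx big1 ?addr0 // => c.
by rewrite eq_sym => /negPf ->.
Qed.

Lemma sum_delta_seq (V : nmodType) (T : eqType) (s : seq T) (x : T) (a : V) :
  uniq s -> x \in s -> \sum_(y <- s) (if y == x then a else 0) = a.
Proof.
move=> us xs; rewrite (bigD1_seq x) //= eqxx big1 ?addr0 // => y /negPf ->.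
by [].
Qed.

Lemma psym_root d n gs : psym (Node (mi0 d) n gs [::]) = 1%N.
Proof. by rewrite /= big_nil mi_fact_mi0. Qed.

Section renormalised_expansion.
Variables (R : realType) (d : nat) (alpha kappa : R) (g f : jetfun R d).
Variables (ell : seq (tree d) -> R) (r eta : R).
Hypothesis gr : gain alpha kappa g f r eta.
Hypothesis hell : renorm_character alpha kappa ell.


Hypotheses (sg : jet_smooth g) (sf : jet_smooth f).
Variables (chi : R -> R) (G xi : stpoint R d -> R).
Variable Gs : seq (ptree d).
Hypotheses (uGs : uniq Gs) (GsP : forall u, u \in Gs <-> contributing alpha kappa g f u).

Let PiE := PiR_scale_zero gr hell chi G xi uGs GsP.
Let cls (u : ptree d) : tree d := \pi_(tree d)%qT u.
Let PiS := PiR g f ell chi G xi 0.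

Lemma PiR_eq0 tau : trees0 tau -> tau \notin tXi :: [seq cls (strip u) | u <- Gs] ->
  PiS tau = fun _ _ => 0.
Proof.
move=> tT; rewrite inE negb_or => /andP[/negPf tX tG].
apply/funext => phi; apply/funext => z; rewrite /PiS PiE // tX addr0 big_seq big1 // => u uG.
case: eqP => [e|]; rewrite ?mul0r //; case/negP: tG; apply/mapP; exists u => //.
by rewrite /cls e reprK.
Qed.

Lemma finite_PiR : finite_set [set tau | trees0 tau /\ PiS tau <> (fun _ _ => 0)].
Proof.
apply: (@sub_finite_set _ _ [set` tXi :: [seq cls (strip u) | u <- Gs]]); last exact: finite_seq.
by move=> tau [tT tP] /=; apply: contra_notT tP; exact: PiR_eq0.
Qed.

Lemma Ups_eq0 sigma : treesX_nonpos alpha kappa sigma -> sigma \notin [seq cls u | u <- Gs] ->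
  Ups g f sigma = fun=> 0.
Proof.
move=> [sT s0]; apply: contraNP => U0; apply/mapP; exists (repr sigma).
  exact/GsP.
by rewrite /cls reprK.
Qed.

Lemma finite_Ups : finite_set [set sigma | treesX_nonpos alpha kappa sigma /\
  (fun z Z => coeff ell xi sigma z * Ups g f sigma Z) <> (fun _ _ => 0)].
Proof.
apply: (@sub_finite_set _ _ [set` [seq cls u | u <- Gs]]); last exact: finite_seq.
move=> sigma [sT sU] /=; apply: contra_notT sU => /(Ups_eq0 sT) ->.
by apply/funext => z; apply/funext => Z; rewrite mulr0.
Qed.

Lemma contributing_iso u v : tree_iso u v -> u \in Gs -> v \in Gs.
Proof.
move=> uv /GsP[uT U0 u0]; apply/GsP; split.
- by rewrite -(in_TX_iso uv).
- by rewrite -(pUps_iso sg sf uv).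
- by rewrite -(pdeg_iso _ _ uv).
Qed.

Lemma in_TX_strip_contributing u : u \in Gs -> in_TX (strip u).
Proof.
move=> /GsP[uT U0 u0]; apply: contraLR u0 => nu; rewrite -ltNge.
exact: (pdeg_bare_leaf gr).
Qed.

(** All trees [u] of the class of [u0] have the same stripped class, so a single
[tau] contributes, and [count_decorate] evaluates its contribution. *)
Lemma class_sum (u0 : ptree d) (TT : seq (tree d)) : u0 \in Gs -> uniq TT ->
  (forall tau, tau \in TT -> trees0 tau) -> cls (strip u0) \in TT ->
  \sum_(tau <- TT) (symf tau)%:R^-1 *
     \sum_(u <- Gs | cls u == cls u0)
       (if strip u == repr tau then (decfact u)%:R^-1 else 0)
  = (symf (cls u0))%:R^-1 :> R.
Proof.
move=> u0G uTT TT0 stT; pose K := undup (node_decs u0).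
have nzS (t : ptree d) : (psym t)%:R != 0 :> R by rewrite pnatr_eq0 -lt0n psym_gt0.
have nzD (t : ptree d) : (decfact t)%:R != 0 :> R.
  by rewrite pnatr_eq0 -lt0n decfact_gt0.
have inner tau : trees0 tau ->
    \sum_(u <- Gs | cls u == cls u0)
       (if strip u == repr tau then (decfact u)%:R^-1 else 0)
    = (if cls (strip u0) == tau then (psym (repr tau))%:R else 0) / (psym u0)%:R :> R.
  move=> /andP[tT tn].
  have := @count_decorate R d K (repr tau) u0 (undup_uniq _) tn.
  rewrite reprK => <-; last by apply/allP => k; rewrite mem_undup.
  transitivity (\sum_(u <- Gs | (cls u == cls u0) && (strip u == repr tau))
      (decfact u0)%:R^-1 : R).
    rewrite [RHS]big_mkcondr; apply: eq_bigr => u /pi_isoP uu0.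
    by rewrite (decfact_iso uu0).
  rewrite big_const_seq iter_addr_0 -mulr_natl.
  have -> : count (fun u => (cls u == cls u0) && (strip u == repr tau)) Gs
      = count (fun p => \pi_(tree d)%qT p == \pi_(tree d)%qT u0) (decorate K (repr tau)).
    rewrite -!size_filter; apply/perm_size/uniq_perm.
    - exact: filter_uniq.
    - by apply: filter_uniq; apply: decorate_uniq; exact: undup_uniq.
    - move=> u; rewrite !mem_filter mem_decorate // -/(cls _) -/(cls u0) -andbA.
      apply: andb_id2l => /pi_isoP uu0; congr (_ && _).
      rewrite (contributing_iso (iso_sym uu0) u0G); apply/esym.
      by rewrite (node_decs_iso _ uu0); apply/allP => k; rewrite mem_undup.
  by field; rewrite nzS nzD.
rewrite (bigD1_seq (cls (strip u0))) //= [X in _ + X]big1_seq => [|tau /andP[ntau tauT]].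
  rewrite inner; last exact: TT0.
  rewrite eqxx addr0 /symf (psym_iso (iso_sym (repr_iso u0))).
  by rewrite mulrA mulVf ?mul1r.
rewrite inner; last exact: TT0.
by rewrite eq_sym (negPf ntau) mul0r mulr0.
Qed.

Lemma Ups_tXi Z : Ups g f tXi Z = f Z.
Proof. by rewrite /Ups repr_tXi /= iter_dir_mi0 mulr1. Qed.

Lemma symf_tXi : symf (@tXi d) = 1%N.
Proof. by rewrite /symf repr_tXi psym_root. Qed.

Lemma trees0_tXi : trees0 (@tXi d).
Proof. by rewrite /trees0 /= repr_tXi /= eqxx !andbT; apply/eqP. Qed.

Lemma tXi_nonpos : alpha <= 1 -> 0 < kappa -> treesX_nonpos alpha kappa (@tXi d).
Proof.
move=> a1 k0; split; first by have /andP[] := trees0_tXi.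
by rewrite /deg repr_tXi /= addr0 sdeg_mi0 addr0; lra.
Qed.

(** The double sum over [tau] and its decorations is exchanged with the sum over
classes; every contributing tree is a decoration of some tree without polynomials
by [pdeg_bare_leaf]. *)
Lemma PiR_expansion phi z : alpha <= 1 -> 0 < kappa ->
  \sum_(tau \in trees0) (symf tau)%:R^-1 * PiS tau phi z
  = \sum_(sigma \in treesX_nonpos alpha kappa)
      coeff ell xi sigma z / (symf sigma)%:R * Ups g f sigma (jet phi z).
Proof.
move=> a1 k0; pose TT := undup (tXi :: [seq cls (strip u) | u <- Gs]).
pose C := undup [seq cls u | u <- Gs]; pose Z := jet phi z.
pose H sigma := ell [:: sigma] * Ups g f sigma Z.
have TT0 tau : tau \in TT -> trees0 tau.
  rewrite mem_undup inE => /predU1P[->|/mapP[u uG ->]]; first exact: trees0_tXi.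
  rewrite /trees0 /= -(in_TX_iso (repr_iso _)) -(no_poly_iso (repr_iso _)).
  by rewrite in_TX_strip_contributing // no_poly_strip.
rewrite (@fsum_seq _ _ _ TT) ?undup_uniq //; last first.
  by move=> tau tT; rewrite mem_undup => /(PiR_eq0 tT) ->; rewrite mulr0.
rewrite [RHS](@fsum_seq _ _ _ C) ?undup_uniq //; last 2 first.
- move=> sigma; rewrite mem_undup => /mapP[u /GsP[uT _ u0] ->]; split.
    by rewrite /treesX /= -(in_TX_iso (repr_iso _)).
  by rewrite /deg -(pdeg_iso _ _ (repr_iso _)).
- by move=> sigma sN; rewrite mem_undup => /(Ups_eq0 sN) ->; rewrite mulr0.
have HE u : ell [:: cls u] * pUps g f u Z = H (cls u).
  by rewrite /H /Ups -(pUps_iso sg sf (repr_iso _)).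
transitivity (\sum_(tau <- TT) (symf tau)%:R^-1 * (\sum_(u <- Gs)
     (if strip u == repr tau then (decfact u)%:R^-1 else 0) * H (cls u))
   + \sum_(tau <- TT) if tau == tXi then xi z * f Z else 0).
  rewrite -big_split; apply: eq_big_seq => tau /TT0 tT /=.
  rewrite /PiS PiE // mulrDr; congr (_ + _).
    by congr (_ * _); apply: eq_bigr => u _; rewrite -HE.
  by case: eqP => [->|_]; rewrite ?mulr0 // symf_tXi invr1 mul1r.
transitivity (\sum_(sigma <- C) H sigma / (symf sigma)%:R + xi z * f Z).
  congr (_ + _); last first.
    by apply: sum_delta_seq; rewrite ?undup_uniq // mem_undup mem_head.
  transitivity (\sum_(tau <- TT) \sum_(sigma <- C) H sigma * ((symf tau)%:R^-1 *
      (\sum_(u <- Gs | cls u == sigma)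
        (if strip u == repr tau then (decfact u)%:R^-1 else 0)))).
    apply: eq_bigr => tau _; rewrite (sum_partition_seq cls) mulr_sumr.
    apply: eq_bigr => sigma _; rewrite [RHS]mulrCA; congr (_ * _).
    rewrite mulr_sumr; apply: eq_bigr => u /eqP ->; exact: mulrC.
  rewrite exchange_big; apply: eq_big_seq => sigma; rewrite mem_undup.
  move=> /mapP[u uG ->]; rewrite -mulr_sumr class_sum ?undup_uniq //.
  by rewrite mem_undup inE; apply/orP; right; apply/mapP; exists u.
transitivity (\sum_(sigma <- C) H sigma / (symf sigma)%:R
   + \sum_(sigma <- C) if sigma == tXi then xi z * f Z else 0).
  congr (_ + _); have [XC|XC] := boolP (tXi \in C).
    by apply/esym; apply: sum_delta_seq; rewrite ?undup_uniq.
  rewrite big1_seq => [|sigma /andP[_ sC]].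
    (* If Xi is not among the contributing trees then f vanishes. *)
    rewrite -Ups_tXi Ups_eq0 ?mulr0 //; first exact: tXi_nonpos.
    by rewrite -mem_undup.
  by case: eqP => // e; rewrite e (negPf XC) in sC.
rewrite -big_split; apply: eq_bigr => sigma _ /=; rewrite /H /coeff.
have [_ _ _ lX] := hell.
case: eqP => [->|_]; last by rewrite addr0 mulrAC.
by rewrite lX Ups_tXi symf_tXi !mul0r add0r invr1 mulr1.
Qed.

End renormalised_expansion.

(** * Translations of the cube *)

Section line.
Local Open Scope ereal_scope.
Variable R : realType.
Local Notation mu := (@lebesgue_measure R).

Lemma measurable_translation (c : R) :
  measurable_fun [set: measurableTypeR R]
    ((fun x => x + c)%R : measurableTypeR R -> measurableTypeR R).
Proof. exact: measurable_funD. Qed.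

Lemma lebesgue_measure_translation (c : R) (A : set R) : measurable A ->
  pushforward mu ((fun x => x + c)%R : R -> measurableTypeR R) A = mu A.
Proof.
move=> mA; apply/esym/lebesgue_measure_unique => //=; first exact: measurable_translation.
move=> _ _ [[a b]] _ <-.
rewrite /pushforward (_ : _ @^-1` _ = `]a - c, b - c]%classic)%R.
  by rewrite !lebesgue_measure_itv/= !lte_fin ltrD2r -!EFinD opprB addrA subrK.
by apply/seteqP; split=> x /=; rewrite !in_itv/= ltrBlDr lerBrDr.
Qed.

Lemma ge0_integral_translation (c : R) (D : set R) (f : R -> \bar R) :
  measurable D -> measurable_fun [set: R] f -> (forall x, 0 <= f x) ->
  \int[mu]_(x in (fun x => x + c)%R @^-1` D) f (x + c)%R = \int[mu]_(x in D) f x.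
Proof.
move=> mD mf f0.
have mfD : measurable_fun D f by exact: measurable_funTS.
have /esym e := @ge0_integral_pushforward _ _ (measurableTypeR R) (measurableTypeR R) R _
  (measurable_translation c) mu D f mD mfD (fun x _ => f0 x).
apply: (etrans e); apply: eq_measure_integral => [|mt A mA _].
  exact: measurable_translation.
exact: lebesgue_measure_translation.
Qed.

(** Modulo a multiple of the period the shift lies in the unit interval, and the part
that leaves this interval on the right is moved back by one period. *)
Lemma ge0_integral_period (c : R) (f : R -> \bar R) :
  measurable_fun [set: R] f -> (forall x, 0 <= f x) -> (forall x, f (x + 1)%R = f x) ->
  \int[mu]_(x in `[0%R, 1%R]) f (x + c)%R = \int[mu]_(x in `[0%R, 1%R]) f x.
Proof.
move=> mf f0 f1.
have mfc e : measurable_fun [set: R] (fun x => f (x + e)%R).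
  exact: measurableT_comp (measurable_translation e).
have co h : measurable_fun [set: R] h ->
    \int[mu]_(x in `[0%R, 1%R]) h x = \int[mu]_(x in `[0%R, 1%R[) h x.
  by move=> mh; rewrite integral_itv_bndo_bndc //; exact: measurable_funTS.
have tr e a b : \int[mu]_(x in `[a, b[) f (x + e)%R
    = \int[mu]_(x in `[(a + e)%R, (b + e)%R[) f x.
  rewrite -[RHS](ge0_integral_translation e) //; congr (\int[mu]_(x in _) _).
  by apply/seteqP; split=> x /=; rewrite !in_itv/= lerD2r ltrD2r.
have U h (a b e : R) : measurable_fun [set: R] h -> (forall x, 0 <= h x) -> (a <= b <= e)%R ->
    \int[mu]_(x in `[a, e[) h x = \int[mu]_(x in `[a, b[) h x + \int[mu]_(x in `[b, e[) h x.
  move=> mh h0 /andP[ab be]; rewrite -ge0_integral_setU //.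
  - congr (\int[mu]_(x in _) _).
    apply/seteqP; split=> x /=; rewrite !in_itv/=.
      by move=> /andP[ax xe]; case: (ltP x b) => ?; [left; rewrite ax|right; rewrite xe].
    move=> [/andP[-> xb]|/andP[bx ->]]; rewrite ?andbT.
      exact: lt_le_trans be.
    exact: le_trans bx.
  - exact: measurable_funTS.
  - apply/disj_setPS => x [] /=; rewrite !in_itv/= => /andP[_ xb] /andP[bx _].
    by have := le_lt_trans bx xb; rewrite ltxx.
pose s := (c - (Num.floor c)%:~R)%R.
have fper (z : int) x : f (x + z%:~R)%R = f x.
  have fn (n : nat) y : f (y + n%:R)%R = f y.
    by elim: n => [|n IH]; rewrite ?addr0 // -natr1 addrA f1 IH.
  case: z => n; first exact: fn.
  by rewrite NegzE mulrNz -[in RHS](subrK (n.+1%:R : R) x) fn.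
have fc x : f (x + c)%R = f (x + s)%R.
  by rewrite /s -[in RHS](fper (Num.floor c)) -addrA subrK.
have s0 : (0 <= s)%R by rewrite subr_ge0 floor_le.
have s1 : (s <= 1)%R.
  by rewrite lerBlDr ltW // addrC (lt_le_trans (floorD1_gt c)) // intrD.
under eq_integral do rewrite fc.
rewrite !co // tr add0r (U _ _ 1%R) ?s1 ?lerDl //.
have -> : \int[mu]_(x in `[1%R, (1 + s)%R[) f x = \int[mu]_(x in `[0%R, s[) f x.
  transitivity (\int[mu]_(x in `[0%R, s[) f (x + 1)%R); first by rewrite tr add0r addrC.
  by apply: eq_integral => x _; rewrite f1.
by rewrite addeC [RHS](U _ _ s) ?s0.
Qed.


(** Both integrals are integrals over the whole line. *)
Lemma ge0_integral_supp (c : R) (f : R -> \bar R) :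
  measurable_fun [set: R] f -> (forall x, 0 <= f x) ->
  (forall x, ~~ (0 < x < 1)%R -> f x = 0) -> (forall x, ~~ (0 < x < 1)%R -> f (x + c)%R = 0) ->
  \int[mu]_(x in `[0%R, 1%R]) f (x + c)%R = \int[mu]_(x in `[0%R, 1%R]) f x.
Proof.
move=> mf f0 f1 f2.
have E h : (forall x, ~~ (0 < x < 1)%R -> h x = 0) ->
    \int[mu]_(x in `[0%R, 1%R]) h x = \int[mu]_x h x.
  move=> h0; rewrite integral_mkcond; apply: eq_integral => x _; rewrite patchE.
  case: ifPn => // /negP xI; rewrite h0 //; apply/negP => /andP[x0 x1]; apply: xI.
  by rewrite inE /= in_itv/= !ltW.
rewrite E // E //.
have := @ge0_integral_translation c setT f measurableT mf f0.
by rewrite preimage_setT.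
Qed.

Lemma integral_uniform01 (f : R -> \bar R) :
  measurable_fun [set: R] f -> (forall x, 0 <= f x) ->
  \int[uniform_prob (@ltr01 R)]_x f x = \int[mu]_(x in `[0%R, 1%R]) f x.
Proof. by move=> mf f0; rewrite integral_uniform // subr0 invr1 mul1e. Qed.

End line.

Section cube.
Local Open Scope ereal_scope.
Variable R : realType.
Local Notation T n := (n.-tuple (measurableTypeR R)).

Lemma integral_cubeS n (u : T n.+1 -> \bar R) :
  measurable_fun [set: T n.+1] u -> (forall w, 0 <= u w) ->
  \int[cube_prob R n.+1]_w u w
  = \int[uniform_prob (@ltr01 R)]_x \int[cube_prob R n]_y u (tcons (x, y)).
Proof.
move=> mu u0.
rewrite [LHS](@ge0_integral_distribution _ _ _ _ _ _ (@tcons R n) u mu u0).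
rewrite fubini_tonelli1 //; last by move=> x; exact: u0.
by apply: measurableT_comp => //; exact: measurable_tcons.
Qed.

Definition tadd n (w c : T n) : T n := [tuple (tnth w i + tnth c i)%R | i < n].

Lemma tadd_cons n x (y : T n) c0 (c : T n) :
  tadd (tcons (x, y)) (tcons (c0, c)) = tcons ((x + c0)%R, tadd y c).
Proof.
apply: eq_from_tnth => i; rewrite tnth_mktuple.
have [j ->|->] := unliftP ord0 i; last by rewrite !tnth0.
by rewrite !tnthS tnth_mktuple.
Qed.

Lemma tcons_eta n (c : T n.+1) : exists c0 c', c = tcons (c0, c').
Proof. by case/tupleP: c => x t; exists x, t; apply: val_inj. Qed.

Lemma measurable_tadd n (c : T n) : measurable_fun [set: T n] (fun w => tadd w c).
Proof.
apply/measurable_fun_tnthP => i /=.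
rewrite (_ : _ \o _ = fun w => (tnth w i + tnth c i)%R); last first.
  by apply/funext => w /=; rewrite tnth_mktuple.
by apply: measurable_funD => //; exact: measurable_tnth.
Qed.

Definition tunit n (i : 'I_n) : T n := [tuple (j == i)%:R%R | j < n].

Lemma tadd_unit0 n (w : T n.+1) x (y : T n) :
  w = tcons (x, y) -> tadd w (tunit ord0) = tcons ((x + 1)%R, y).
Proof.
move=> ->; apply: eq_from_tnth => i; rewrite tnth_mktuple tnth_mktuple.
have [j ->|->] := unliftP ord0 i; last by rewrite !tnth0 eqxx.
by rewrite !tnthS addr0.
Qed.

Lemma tadd_unitS n (y : T n) x (i : 'I_n) :
  tadd (tcons (x, y)) (tunit (lift ord0 i)) = tcons (x, tadd y (tunit i)).
Proof.
apply: eq_from_tnth => j; rewrite tnth_mktuple tnth_mktuple.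
have [k ->|->] := unliftP ord0 j; last by rewrite !tnth0 addr0.
by rewrite !tnthS !tnth_mktuple (inj_eq lift_inj).
Qed.

Lemma measurable_slice n (u : T n.+1 -> \bar R) x :
  measurable_fun [set: T n.+1] u -> measurable_fun [set: T n] (fun y => u (tcons (x, y))).
Proof.
move=> mu; apply: (measurableT_comp mu); apply: (measurableT_comp (@measurable_tcons R n)).
exact: measurable_fun_pair.
Qed.

Lemma measurable_slice_integral n (u : T n.+1 -> \bar R) :
  measurable_fun [set: T n.+1] u -> (forall w, 0 <= u w) ->
  measurable_fun [set: R] (fun x => \int[cube_prob R n]_y u (tcons (x, y))).
Proof.
move=> mu u0; apply: (@measurable_fun_fubini_tonelli_F _ _ _ _ _ (cube_prob R n)
  (fun xy => u (tcons xy))) => //.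
by apply: measurableT_comp => //; exact: measurable_tcons.
Qed.

Lemma integral_cube_period n (u : T n -> \bar R) (c : T n) :
  measurable_fun [set: T n] u -> (forall w, 0 <= u w) ->
  (forall i w, u (tadd w (tunit i)) = u w) ->
  \int[cube_prob R n]_w u (tadd w c) = \int[cube_prob R n]_w u w.
Proof.
elim: n u c => [|n IH] u c mu u0 per.
  by apply: eq_integral => w _; congr (u _); apply: eq_from_tnth => -[].
have [c0 [c' ->]] := tcons_eta c.
rewrite integral_cubeS //; last by apply: (measurableT_comp mu); exact: measurable_tadd.
rewrite [RHS]integral_cubeS //.
pose V x := \int[cube_prob R n]_y u (tcons (x, y)).
have mV : measurable_fun [set: R] V by exact: measurable_slice_integral.
have V0 x : 0 <= V x by apply: integral_ge0.
transitivity (\int[uniform_prob (@ltr01 R)]_x V (x + c0)%R).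
  apply: eq_integral => x _; under eq_integral do rewrite tadd_cons.
  apply: (IH (fun y => u (tcons ((x + c0)%R, y)))) => //; first exact: measurable_slice.
  by move=> i y; rewrite -tadd_unitS per.
rewrite !integral_uniform01 //; last first.
  exact: (measurableT_comp mV (measurable_translation c0)).
apply: ge0_integral_period => // x; apply: eq_integral => y _.
by rewrite -(tadd_unit0 erefl) per.
Qed.

(** Time is the first coordinate and is not periodic; instead the function and its
translate vanish outside the unit interval in time. *)
Lemma integral_cube_translation n (u : T n.+1 -> \bar R) (c : T n.+1) :
  measurable_fun [set: T n.+1] u -> (forall w, 0 <= u w) ->
  (forall i w, i != ord0 -> u (tadd w (tunit i)) = u w) ->
  (forall w, ~~ (0 < thead w < 1)%R -> u w = 0) ->
  (forall w, ~~ (0 < thead w < 1)%R -> u (tadd w c) = 0) ->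
  \int[cube_prob R n.+1]_w u (tadd w c) = \int[cube_prob R n.+1]_w u w.
Proof.
have [c0 [c' ->]] := tcons_eta c; move=> mu u0 per supp suppc.
rewrite integral_cubeS //; last by apply: (measurableT_comp mu); exact: measurable_tadd.
rewrite [RHS]integral_cubeS //.
pose V x := \int[cube_prob R n]_y u (tcons (x, y)).
have mV : measurable_fun [set: R] V by exact: measurable_slice_integral.
have V0 x : 0 <= V x by apply: integral_ge0.
have VE x : \int[cube_prob R n]_y u (tadd (tcons (x, y)) (tcons (c0, c'))) = V (x + c0)%R.
  under eq_integral do rewrite tadd_cons.
  apply: (@integral_cube_period n (fun y => u (tcons ((x + c0)%R, y)))) => //.
    exact: measurable_slice.
  by move=> i y; rewrite -tadd_unitS per.
under eq_integral do rewrite VE.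
rewrite !integral_uniform01 //; last first.
  exact: (measurableT_comp mV (measurable_translation c0)).
apply: ge0_integral_supp => // x nx.
  by apply: integral0_eq => y _; exact: supp.
by rewrite -VE; apply: integral0_eq => y _; exact: suppc.
Qed.

End cube.

(** * Functions on space-time *)

Section spacetime.
Variables (R : realType) (d : nat).
Local Notation T n := (n.-tuple (measurableTypeR R)).
Local Notation st := (@to_stpoint R d).
Implicit Types (u h : stpoint R d -> R) (z c : stpoint R d).

Lemma to_stpoint_add (w c : T d.+1) : st (tadd w c) = st w + st c.
Proof. by apply/rowP => i; rewrite !mxE tnth_mktuple. Qed.

Lemma to_stpoint_unit (i : 'I_d.+1) : st (tunit R i) = delta_mx ord0 i.
Proof. by apply/rowP => j; rewrite !mxE tnth_mktuple. Qed.

Lemma time_to_stpoint (w : T d.+1) : time (st w) = thead w.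
Proof. by rewrite /time mxE. Qed.

(** An open set of the space of vectors is a countable union of boxes with rational
ends, and boxes belong to the product sigma-algebra. *)
Lemma measurable_continuous h : continuous h -> measurable_fun [set: T d.+1] (h \o st).
Proof.
move=> hc _; apply: (measurability _ (RGenOInfty.measurableE R)) => //.
move=> _ [_ [a ->] <-]; rewrite setTI.
pose U := h @^-1` `]a, +oo[%classic.
have oU : open U by apply: open_comp => [z _|]; [exact: hc|exact: interval_open].
pose box (q : d.+1.-tuple (rat * rat)) : set (T d.+1) :=
  [set w | forall i, (ratr (tnth q i).1 < tnth w i < ratr (tnth q i).2)].
have mbox q : measurable (box q).
  rewrite (_ : box q = \bigcap_(i in [set: 'I_d.+1])
      ((fun w : T d.+1 => tnth w i) @^-1` `]ratr (tnth q i).1, ratr (tnth q i).2[%classic)).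
    apply: fin_bigcap_measurable => // i _; rewrite -[X in measurable X]setTI.
    exact: measurable_tnth.
  apply/seteqP; split=> w /= H i; first by move=> _; rewrite /= in_itv/=.
  by have := H i I; rewrite /= in_itv/=.
rewrite (_ : _ @^-1` _ = \bigcup_q (if `[< box q `<=` st @^-1` U >] then box q else set0)).
  apply: countable_bigcupT_measurable => [|q]; first exact: countableP.
  by case: asboolP.
apply/seteqP; split=> [w /= wU|w /= [q _]]; last first.
  by case: asboolP => // qU /qU.
have : nbhs (st w) U by rewrite openE in oU; exact: oU.
move=> [P Pw PU].
have H i : exists ab : rat * rat, ratr ab.1 < tnth w i < ratr ab.2 /\
    forall x : R, ratr ab.1 < x < ratr ab.2 -> P ord0 i x.
  have := Pw ord0 i; rewrite mxE => /nbhs_ballP[e /= e0 eP].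
  have [|q1 q1w] := @rat_in_itvoo R (tnth w i - e) (tnth w i); first by rewrite ltrBlDr ltrDl.
  have [|q2 q2w] := @rat_in_itvoo R (tnth w i) (tnth w i + e); first by rewrite ltrDl.
  exists (q1, q2); move: q1w q2w; rewrite !in_itv/= => /andP[q11 q12] /andP[q21 q22].
  split => [|x /andP[x1 x2]]; first by rewrite q12 q21.
  apply: eP; rewrite /ball/= ltr_distlC.
  by rewrite (lt_trans q11 x1) (lt_trans x2 q22).
have [q Hq] := choice H.
exists [tuple q i | i < d.+1] => //; case: asboolP => [_ i|].
  by rewrite tnth_mktuple; have [] := Hq i.
case=> v bv; apply: PU => i j; rewrite (ord1 i) mxE; apply: (Hq j).2.
by have := bv j; rewrite tnth_mktuple.
Qed.

Lemma space_periodicZ u (k : 'I_d.+1 -> int) z : space_periodic u -> k ord0 = 0 ->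
  u (z + \row_i (k i)%:~R) = u z.
Proof.
move=> up k0.
have up1 (i : 'I_d.+1) (n : int) y : i != ord0 -> u (y + delta_mx ord0 i *~ n) = u y.
  move=> i0; have upn (m : nat) x : u (x + delta_mx ord0 i *+ m) = u x.
    by elim: m => [|m IH]; rewrite ?addr0 // mulrSr addrA up.
  case: n => n; first exact: upn.
  by rewrite NegzE mulrNz -[in RHS](subrK (delta_mx ord0 i *+ n.+1) y) upn.
have -> : (\row_i (k i)%:~R : stpoint R d) = \sum_i delta_mx ord0 i *~ k i.
  apply/rowP => j; rewrite !mxE summxE (bigD1 j) //= big1 => [|i ij].
    by rewrite -[delta_mx _ _ *~ _]scaler_int !mxE eqxx addr0 mulr1.
  by rewrite -[delta_mx _ _ *~ _]scaler_int !mxE [j == _]eq_sym (negPf ij) andbF mulr0.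
elim: (index_enum _) z => [|i s IH] z; first by rewrite big_nil addr0.
rewrite big_cons addrA IH; have [->|i0] := eqVneq i ord0; last exact: up1.
by rewrite k0 mulr0z addr0.
Qed.

(** Spatial coordinates are moved to the unit interval, where compactness applies. *)
Lemma periodic_bounded u : continuous u -> space_periodic u ->
  exists2 M : R, 0 <= M & forall z, slab z -> `|u z| <= M.
Proof.
move=> uc up.
pose K : set (stpoint R d) := [set v | forall i, `[0, 1]%classic (v ord0 i)].
have cK : compact K.
  by apply: (@rV_compact R d.+1 (fun=> `[0, 1]%classic)) => _; exact: segment_compact.
have : compact (u @` K) by apply: continuous_compact => //; exact: continuous_subspaceT.
move=> /compact_bounded[M [Mr HM]].
exists (`|M| + 1) => [|z z01]; first by rewrite addr_ge0.
(* Integer parts of the spatial coordinates; time already lies in the interval. *)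
pose k i : int := if i == ord0 then 0 else - Num.floor (z ord0 i).
rewrite -(@space_periodicZ u k z up) ?/k ?eqxx //.
apply: (HM (`|M| + 1)); first by rewrite (le_lt_trans (ler_norm M)) // ltrDl.
exists (z + \row_i (k i)%:~R) => // i; rewrite /= !mxE in_itv/= /k.
have [->|_] := eqVneq i ord0.
  by move: z01; rewrite /slab /time /= addr0 => /andP[/ltW -> /ltW ->].
rewrite mulrNz subr_ge0 floor_le lerBlDr ltW // addrC.
by rewrite (lt_le_trans (floorD1_gt _)) // intrD.
Qed.

End spacetime.

(** * The adjoint heat operator *)

Section heat.
Variables (R : realType) (d : nat).
Implicit Types (u h eta : stpoint R d -> R) (z c : stpoint R d).

Definition translate c u : stpoint R d -> R := fun y => u (c + y).

(** Proved on difference quotients, since [u] need not be differentiable. *)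
Lemma partial_translate i c u : partial i (translate c u) = translate c (partial i u).
Proof.
apply/funext => y.
have e : (fun t : R => t^-1 *: ((translate c u \o shift y) (t *: delta_mx ord0 i)
      - translate c u y))
    = (fun t : R => t^-1 *: ((u \o shift (c + y)) (t *: delta_mx ord0 i) - u (c + y))).
  by apply/funext => t; rewrite /translate /= addrCA.
by rewrite /partial /derive e.
Qed.

Lemma sub_sum_congr (a a' : R) (b b' : 'I_d.+1 -> R) :
  a = a' -> (forall i, b i = b' i) ->
  - a - \sum_(i | i != ord0) b i = - a' - \sum_(i | i != ord0) b' i.
Proof. by move=> -> e; congr (_ - _); apply: eq_bigr. Qed.

Lemma heat_adj_translate c u : heat_adj (translate c u) = translate c (heat_adj u).
Proof.
apply/funext => y.
have E i : partial i (partial i (translate c u)) y = partial i (partial i u) (c + y).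
  by rewrite !partial_translate.
have E0 : partial ord0 (translate c u) y = partial ord0 u (c + y).
  by rewrite partial_translate.
exact: (sub_sum_congr E0 E).
Qed.

Lemma smooth_translate c u : smooth_on setT u -> smooth_on setT (translate c u).
Proof.
move=> su s z _.
have -> : foldr (@partial R d) (translate c u) s = translate c (foldr (@partial R d) u s).
  by elim: s => //= i s ->; exact: partial_translate.
have [cu du] := su s (c + z) I; split=> [|i].
  apply: (@continuous_comp _ _ _ (fun y => c + y)) => //.
  by apply: (@continuousD _ _ _ (cst c) id z); [exact: cst_continuous|exact: cvg_id].
have := du i; rewrite /derivable.
set v := foldr _ u s.
rewrite (_ : (fun t => _) = (fun t : R =>
   t^-1 *: ((translate c v \o shift z) (t *: delta_mx ord0 i) - translate c v z))) //.
by apply/funext => t /=; rewrite /translate addrCA.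
Qed.

Lemma periodic_translateP u : space_periodic u <->
  forall i : 'I_d.+1, i != ord0 -> translate (delta_mx ord0 i) u = u.
Proof.
split=> up i => [i0|z i0]; first by apply/funext => z; rewrite /translate addrC up.
by rewrite addrC -[LHS]/(translate _ u z) up.
Qed.

Lemma periodic_heat_adj u : space_periodic u -> space_periodic (heat_adj u).
Proof.
move=> /periodic_translateP up; apply/periodic_translateP => i i0.
by rewrite -heat_adj_translate up.
Qed.

Lemma periodic_translate c u : space_periodic u -> space_periodic (translate c u).
Proof. by move=> up i z i0; rewrite /translate addrA up. Qed.

Lemma continuous_heat_adj u : smooth_on setT u -> continuous (heat_adj u).
Proof.
move=> su z.
have c1 : {for z, continuous (partial ord0 u)} by have [] := su [:: ord0] z I.
have c2 i : {for z, continuous (partial i (partial i u))} by have [] := su [:: i; i] z I.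
apply: (@continuousB _ _ _ (fun z => - partial ord0 u z)
  (fun z => \sum_(i < d.+1 | i != ord0) partial i (partial i u) z) z).
  exact: (continuousN c1).
elim: (index_enum _) => [|i s IH].
  rewrite (_ : (fun z => _) = cst 0); first exact: cst_continuous.
  by apply/funext => y; rewrite big_nil.
have [i0|i0] := eqVneq i ord0.
  rewrite (_ : (fun z => _) = (fun z => \sum_(i <- s | i != ord0) partial i (partial i u) z)) //.
  by apply/funext => y; rewrite big_cons i0 eqxx.
rewrite (_ : (fun z => _) = (partial i (partial i u) \+
  (fun z => \sum_(i <- s | i != ord0) partial i (partial i u) z))).
  exact: (continuousD (c2 i) IH).
by apply/funext => y; rewrite big_cons i0.
Qed.

Lemma partial_eq0 (A : set (stpoint R d)) i u : open A -> (forall z, A z -> u z = 0) ->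
  forall z, A z -> partial i u z = 0.
Proof.
move=> oA u0 z Az; rewrite /partial -(@derive_cst R _ _ (0 : R) z (delta_mx ord0 i)).
apply: near_eq_derive; apply: filterS (open_nbhs_nbhs (conj oA Az)).
by move=> y /u0.
Qed.

Lemma heat_adj_eq0 (A : set (stpoint R d)) u : open A -> (forall z, A z -> u z = 0) ->
  forall z, A z -> heat_adj u z = 0.
Proof.
move=> oA u0 z Az; rewrite /heat_adj (partial_eq0 _ oA u0) // big1 ?subr0 ?oppr0 // => i _.
by apply: (partial_eq0 i oA _ Az); exact: partial_eq0.
Qed.

Lemma open_time (B : set R) : open B -> open ((@time R d) @^-1` B).
Proof. by move=> oB; apply: open_comp => // z _; exact: coord_continuous. Qed.

(** The test function vanishes on the open sets of times before [t0] and after [t1],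
and so do its derivatives; this includes the ends of the time interval. *)
Lemma heat_adj_test eta (t0 t1 : R) : 0 < t0 -> t1 < 1 ->
  (forall z, ~~ (t0 < time z < t1) -> eta z = 0) ->
  forall z, ~~ (0 < time z < 1) -> heat_adj eta z = 0.
Proof.
move=> t00 t11 e0 z; rewrite negb_and -!leNgt => /orP[zt|zt].
  apply: (@heat_adj_eq0 ((@time R d) @^-1` `]-oo, t0[%classic)).
  - by apply: open_time; exact: interval_open.
  - by move=> y; rewrite /= in_itv/= => yt; apply: e0; rewrite negb_and -leNgt (ltW yt).
  - by rewrite /= in_itv/= (le_lt_trans zt).
apply: (@heat_adj_eq0 ((@time R d) @^-1` `]t1, +oo[%classic)).
- by apply: open_time; exact: interval_open.
- move=> y; rewrite /= in_itv/= andbT => yt; apply: e0.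
  by rewrite negb_and -!leNgt (ltW yt) orbT.
- by rewrite /= in_itv/= andbT (lt_le_trans _ zt).
Qed.

End heat.

(** * Real-valued integrals *)

Section real_integral.
Context dd (X : measurableType dd) (R : realType) (mu : {measure set X -> \bar R}).
Implicit Types h : X -> R.

(** The integral is then infinite, and its real part is zero by convention. *)
Lemma Rintegral_nonintegrable h : measurable_fun setT h ->
  ~ mu.-integrable setT (EFin \o h) -> \int[mu]_x h x = 0.
Proof.
move=> mh; apply: contra_notP => hn0.
have mEh : measurable_fun setT (EFin \o h) by exact/measurable_EFinP.
have fin : (\int[mu]_x (h x)%:E)%E \is a fin_num.
  by move: hn0; rewrite /Rintegral; case: (\int[mu]_x _)%E.
by apply/integrableP; split => //; rewrite integral_fin_num_abs.
Qed.

(** True without integrability, since integrability is not affected by a nonzero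
factor.  The convolution may fail to be defined on a null set of points. *)
Lemma Rintegral_mulr h (c : R) : measurable_fun setT h ->
  \int[mu]_x (h x * c) = (\int[mu]_x h x) * c.
Proof.
move=> mh; have [->|c0] := eqVneq c 0.
  rewrite mulr0 (_ : (fun x => h x * 0) = fun=> 0); last by apply/funext => x; rewrite mulr0.
  by rewrite /Rintegral integral0.
have [ih|nih] := pselect (mu.-integrable setT (EFin \o h)).
  exact: RintegralZr.
rewrite (Rintegral_nonintegrable mh nih) mul0r Rintegral_nonintegrable //.
  exact: measurable_funM.
move=> ih; apply: nih.
have := integrableZr measurableT c^-1 ih; apply: eq_integrable => // x _ /=.
by rewrite -EFinM mulfK.
Qed.

End real_integral.

Section fubini_real.
Context d1 d2 (X : measurableType d1) (Y : measurableType d2) (R : realType).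
Variables (m1 : {sigma_finite_measure set X -> \bar R})
  (m2 : {sigma_finite_measure set Y -> \bar R}) (H : X -> Y -> R).

Lemma Rintegral_Fubini : (m1 \x m2)%E.-integrable setT (fun p => (H p.1 p.2)%:E) ->
  \int[m1]_x \int[m2]_y H x y = \int[m2]_y \int[m1]_x H x y.
Proof.
move=> iH; rewrite /Rintegral; congr fine.
transitivity (\int[m1]_x \int[m2]_y (H x y)%:E)%E.
  apply: ae_eq_integral => //.
  - apply/measurable_EFinP; apply: (measurableT_comp (fine_measurable measurableT)) => //.
    exact: (measurable_fubini_F iH).
  - exact: (measurable_fubini_F iH).
  - apply: filterS (ae_integrable1 iH) => x ix _; rewrite fineK //.
    exact: (integrable_fin_num measurableT ix).
rewrite (Fubini iH).
apply/esym; apply: ae_eq_integral => //.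
- apply/measurable_EFinP; apply: (measurableT_comp (fine_measurable measurableT)) => //.
  exact: (measurable_fubini_G iH).
- exact: (measurable_fubini_G iH).
- apply: filterS (ae_integrable2 iH) => x ix _; rewrite fineK //.
  exact: (integrable_fin_num measurableT ix).
Qed.

End fubini_real.

(** * Convolution with the Green kernel *)

Section heat_solution.
Variables (R : realType) (d : nat).
Local Notation T := (d.+1.-tuple (measurableTypeR R)).
Local Notation st := (@to_stpoint R d).
Local Notation P := (cube_prob R d.+1).
Implicit Types (u h G F phi eta : stpoint R d -> R).

Definition topp (w : T) : T := [tuple (- tnth w i : measurableTypeR R) | i < d.+1].

Lemma to_stpoint_opp (w : T) : st (topp w) = - st w.
Proof. by apply/rowP => i; rewrite !mxE tnth_mktuple. Qed.

Lemma tadd_oppK (z w : T) : tadd (tadd z (topp w)) w = z.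
Proof. by apply: eq_from_tnth => i; rewrite !tnth_mktuple subrK. Qed.

Lemma taddAC (z w c : T) : tadd (tadd z w) c = tadd (tadd z c) w.
Proof. by apply: eq_from_tnth => i; rewrite !tnth_mktuple addrAC. Qed.

Lemma measurable_tsub :
  measurable_fun [set: T * T] (fun p : T * T => tadd p.1 (topp p.2)).
Proof.
apply/measurable_fun_tnthP => i.
rewrite (_ : _ \o _ = (fun p : T * T => tnth p.1 i - tnth p.2 i)); last first.
  by apply/funext => p /=; rewrite !tnth_mktuple.
by apply: measurable_funB; apply: (measurableT_comp (measurable_tnth i)).
Qed.

Definition slabT : set T := [set w | slab (st w)].

Lemma slabTE (w : T) : slabT w = (0 < thead w < 1).
Proof. by rewrite /slabT /slab /= time_to_stpoint. Qed.

Lemma measurable_slabT : measurable slabT.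
Proof.
rewrite (_ : slabT = (fun w : T => tnth w ord0) @^-1` `]0, 1[%classic).
  by rewrite -[X in measurable X]setTI; exact: measurable_tnth.
by apply/seteqP; split=> w; rewrite slabTE /= in_itv.
Qed.

(** The function on the whole cube that is used to integrate over the slab. *)
Definition slab_cut (u : stpoint R d -> R) (w : T) : R := if 0 < thead w < 1 then u (st w) else 0.

Lemma slab_intE u : slab_int u = \int[P]_w slab_cut u w.
Proof.
rewrite /slab_int Rintegral_mkcond; apply: eq_Rintegral => w _.
rewrite patchE /slab_cut; congr (if _ then _ else _).
by apply/idP/idP => [/set_mem|wD]; [|apply/mem_set]; rewrite -/(slabT w) slabTE.
Qed.

Lemma integrable_slab_cut u : slab_integrable u -> P.-integrable setT (EFin \o slab_cut u).
Proof.
move=> /(integrable_mkcond _ measurable_slabT); apply: eq_integrable => // w _.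
rewrite patchE /slab_cut /=; case: ifPn => [/set_mem|/negP wD].
  by rewrite -/(slabT w) slabTE => ->.
by case: ifPn => // w01; case: wD; apply/mem_set; rewrite -/(slabT w) slabTE.
Qed.

(** Positive and negative parts are translated separately. *)
Lemma integral_translation_signed (u : T -> R) (c : T) :
  measurable_fun setT u -> (forall i w, i != ord0 -> u (tadd w (tunit R i)) = u w) ->
  (forall w, ~~ (0 < thead w < 1) -> u w = 0) ->
  (forall w, ~~ (0 < thead w < 1) -> u (tadd w c) = 0) ->
  \int[P]_w u (tadd w c) = \int[P]_w u w.
Proof.
move=> mu per s1 s2; rewrite /Rintegral; congr fine.
have mEu : measurable_fun setT (EFin \o u) by exact/measurable_EFinP.
have key (m : \bar R -> \bar R) : measurable_fun setT m -> (forall x, 0 <= m x)%E ->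
    m 0%E = 0%E -> (\int[P]_w m (u (tadd w c))%:E = \int[P]_w m (u w)%:E)%E.
  move=> mm m0 m00; apply: (@integral_cube_translation R d (fun w => m (u w)%:E) c) => //.
  - exact: measurableT_comp mm mEu.
  - by move=> i w i0; rewrite per.
  - by move=> w /s1 ->.
  - by move=> w /s2 ->.
rewrite integralE [RHS]integralE; congr (_ - _)%E.
- under eq_integral do rewrite funeposE.
  under [RHS]eq_integral do rewrite funeposE.
  apply: (key (fun x => maxe x 0%E)) => [|x|].
  + by apply: measurable_maxe => //; exact: measurable_cst.
  + by rewrite le_max lexx orbT.
  + exact: maxxx.
- under eq_integral do rewrite funenegE.
  under [RHS]eq_integral do rewrite funenegE.
  apply: (key (fun x => maxe (- x)%E 0%E)) => [|x|].
  + apply: measurable_maxe; last exact: measurable_cst.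
    exact: oppe_measurable.
  + by rewrite le_max lexx orbT.
  + by rewrite oppe0 maxxx.
Qed.

Lemma slab_cut_periodic u (i : 'I_d.+1) (w : T) : space_periodic u -> i != ord0 ->
  slab_cut u (tadd w (tunit R i)) = slab_cut u w.
Proof.
move=> up i0; rewrite /slab_cut to_stpoint_add to_stpoint_unit up //.
suff -> : thead (tadd w (tunit R i)) = thead w by [].
by rewrite /thead !tnth_mktuple eq_sym (negPf i0) addr0.
Qed.

Section exchange.
Variables (G1 F1 L1 : T -> R) (M : R).
Hypotheses (iG1 : P.-integrable setT (EFin \o G1)) (iF1 : P.-integrable setT (EFin \o F1)).
Hypotheses (mL1 : measurable_fun setT L1) (LM : forall w, `|L1 w| <= M).
Hypotheses (G1per : forall i w, i != ord0 -> G1 (tadd w (tunit R i)) = G1 w)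
  (L1per : forall i w, i != ord0 -> L1 (tadd w (tunit R i)) = L1 w).
Hypotheses (G10 : forall w, ~~ (0 < thead w < 1) -> G1 w = 0)
  (L10 : forall w, ~~ (0 < thead w < 1) -> L1 w = 0).

Let mG1 : measurable_fun setT G1.
Proof. by apply/measurable_EFinP; exact: measurable_int iG1. Qed.

Let mF1 : measurable_fun setT F1.
Proof. by apply/measurable_EFinP; exact: measurable_int iF1. Qed.

Let H (z w : T) := G1 (tadd z (topp w)) * F1 w * L1 z.

Let mH : measurable_fun [set: T * T] (fun p : T * T => H p.1 p.2).
Proof.
have m1 : measurable_fun [set: T * T] (fun p : T * T => G1 (tadd p.1 (topp p.2))).
  exact: (measurableT_comp mG1 measurable_tsub).
have m2 : measurable_fun [set: T * T] (fun p : T * T => F1 p.2).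
  exact: (measurableT_comp mF1 measurable_snd).
have m3 : measurable_fun [set: T * T] (fun p : T * T => L1 p.1).
  exact: (measurableT_comp mL1 measurable_fst).
exact: measurable_funM (measurable_funM m1 m2) m3.
Qed.

(* The integrand in the variable y = z - w. *)
Let v w (y : T) := G1 y * L1 (tadd y w).

Let vE w z : G1 (tadd z (topp w)) * L1 z = v w (tadd z (topp w)).
Proof. by rewrite /v tadd_oppK. Qed.

Let mv w : measurable_fun setT (v w).
Proof. exact: measurable_funM mG1 (measurableT_comp mL1 (measurable_tadd w)). Qed.

Let vper w i y : i != ord0 -> v w (tadd y (tunit R i)) = v w y.
Proof. by move=> i0; rewrite /v G1per // taddAC L1per. Qed.

Let v0 w y : ~~ (0 < thead y < 1) -> v w y = 0.
Proof. by move=> y01; rewrite /v G10 // mul0r. Qed.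

Let v0' w y : ~~ (0 < thead y < 1) -> v w (tadd y (topp w)) = 0.
Proof. by move=> /L10 e; rewrite -vE e mulr0. Qed.

Let mabs (h : T -> R) : measurable_fun setT h -> measurable_fun setT (fun y => `|(h y)%:E|%E).
Proof. by move=> mh; apply: measurableT_comp => //; exact/measurable_EFinP. Qed.

Let integral_kernel w : (\int[P]_z `|(v w (tadd z (topp w)))%:E| <=
  M%:E * \int[P]_y `|(G1 y)%:E|)%E.
Proof.
have M0 : 0 <= M by apply: le_trans (LM w).
rewrite (@integral_cube_translation R d (fun y => `|(v w y)%:E|%E) (topp w)) //.
- rewrite -ge0_integralZl //; last exact: mabs.
  apply: ge0_le_integral => //; first exact: mabs.
    by apply: emeasurable_funM; [exact: measurable_cst|exact: mabs].
  move=> y _; rewrite /v EFinM abseM muleC; apply: lee_wpmul2r => //.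
  by rewrite lee_fin; exact: LM.
- exact: mabs.
- by move=> i y i0; rewrite vper.
- by move=> y y01; rewrite v0 // abse0.
- by move=> y y01; rewrite v0' // abse0.
Qed.

Let iH : (P \x P)%E.-integrable setT (fun p => (H p.1 p.2)%:E).
Proof.
apply/integrable21ltyP; first exact/measurable_EFinP.
have M0 : 0 <= M by apply: le_trans (LM [tuple 0 | i < d.+1]).
pose B := (M%:E * \int[P]_y `|(G1 y)%:E|)%E.
have B0 : (0 <= B)%E by apply: mule_ge0 => //; exact: integral_ge0.
have Bfin : B = (fine B)%:E.
  rewrite fineK // fin_numM // ge0_fin_numE; last exact: integral_ge0.
  by have /integrableP[] := iG1.
have mFB : measurable_fun setT (fun w => (`|(F1 w)%:E| * B)%E).
  by apply: emeasurable_funM; [exact: mabs|exact: measurable_cst].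
apply: (@le_lt_trans _ _ (\int[P]_w (`|(F1 w)%:E| * B))%E).
  apply: ge0_le_integral => //.
  - by move=> w _; apply: integral_ge0.
  - apply: (measurable_fun_fubini_tonelli_G (fun p => `|(H p.1 p.2)%:E|%E)) => //.
    by apply: measurableT_comp => //; exact/measurable_EFinP.
  move=> w _.
  have -> : (\int[P]_z `|(H z w)%:E|)%E =
      (\int[P]_z (`|(F1 w)%:E| * `|(v w (tadd z (topp w)))%:E|))%E.
    apply: eq_integral => z _; rewrite -vE -abseM -EFinM /H.
    by rewrite mulrCA mulrA.
  rewrite ge0_integralZl //; last first.
    by apply: mabs; exact: (measurableT_comp (mv w) (measurable_tadd _)).
  by apply: lee_wpmul2l => //; exact: integral_kernel.
rewrite Bfin; under eq_integral do rewrite muleC.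
rewrite ge0_integralZl //; first last.
- by rewrite lee_fin fine_ge0.
- exact: mabs.
by apply: lte_mul_pinfty; rewrite ?lee_fin ?fine_ge0 //; have /integrableP[] := iF1.
Qed.

(** Fubini, then the change of variables [y = z - w].  Translation in time is allowed
because [G1] lives on times in the unit interval and [L1], evaluated at [z], does
too. *)
Lemma Rintegral_exchange :
  \int[P]_z ((\int[P]_w (G1 (tadd z (topp w)) * F1 w)) * L1 z)
  = \int[P]_w (F1 w * \int[P]_y (G1 y * L1 (tadd y w))).
Proof.
transitivity (\int[P]_z \int[P]_w H z w).
  apply: eq_Rintegral => z _; rewrite -Rintegral_mulr //.
  apply: measurable_funM => //.
  have mz : measurable_fun [set: T] (fun w : T => (z, w)) by exact: measurable_fun_pair.
  exact: (measurableT_comp mG1 (measurableT_comp measurable_tsub mz)).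
rewrite (Rintegral_Fubini iH); apply: eq_Rintegral => w _.
rewrite -(integral_translation_signed (mv w) (vper w) (v0 w) (v0' w)).
rewrite [RHS]mulrC -Rintegral_mulr; last first.
  exact: (measurableT_comp (mv w) (measurable_tadd _)).
by apply: eq_Rintegral => z _; rewrite -vE mulrAC.
Qed.

End exchange.

(** By [Rintegral_exchange] the function [F] at [w] is multiplied by the pairing of
[G] with [L^* eta] translated by [w], which is [eta] at [w].  The translated test
function vanishes from the time [t1 - time w < 1] on, as the definition of the Green
kernel requires. *)
Lemma conv_solves_heat G F phi : green_kernel G -> slab_integrable F ->
  (forall z, slab z -> phi z = Defs.conv G F z) -> solves_heat phi F.
Proof.
move=> [Gper G0 Gint Ggreen] Fint phiE eta es ep [t0 [t1 [t00 t11 e0]]].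
have L0 z : ~~ (0 < time z < 1) -> heat_adj eta z = 0 by exact: heat_adj_test e0 z.
have Lc : continuous (heat_adj eta) by exact: continuous_heat_adj.
have Lp : space_periodic (heat_adj eta) by exact: periodic_heat_adj.
have LT c : heat_adj (translate c eta) = translate c (heat_adj eta).
  exact: heat_adj_translate.
(* The Green kernel tested against the translates of eta. *)
have {}Ggreen w : 0 < time w < 1 ->
    slab_int (fun z => G z * translate w (heat_adj eta) z) = eta w.
  move=> /andP[w0 w1]; rewrite -LT Ggreen ?/translate ?addr0 //.
  - exact: smooth_translate.
  - exact: periodic_translate.
  - exists (t1 - time w) => [|z zt]; first by lra.
    apply: e0; rewrite negb_and -!leNgt; apply/orP; right.
    by rewrite /time mxE -/(time z) -/(time w); lra.
(* From here on only these properties of the adjoint heat operator matter. *)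
move: (heat_adj eta) L0 Lc Lp Ggreen {LT} => L L0 Lc Lp Ggreen.
have [M M0 LM'] := periodic_bounded Lc Lp.
have LM z : `|L z| <= M.
  by have [zD|zD] := boolP (0 < time z < 1); [exact: LM'|rewrite L0 // normr0].
have ex := @Rintegral_exchange (slab_cut G) (slab_cut F) (L \o st) M (integrable_slab_cut Gint)
  (integrable_slab_cut Fint) (measurable_continuous Lc) (fun w => LM (st w)).
rewrite !slab_intE.
transitivity (\int[P]_z (\int[P]_w (slab_cut G (tadd z (topp w)) * slab_cut F w) * (L \o st) z)).
  apply: eq_Rintegral => z _; rewrite /slab_cut /=.
  case: ifPn => [z01|z01]; last by rewrite L0 ?mulr0 // time_to_stpoint.
  congr (_ * _); rewrite phiE; last by rewrite /slab /= time_to_stpoint.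
  rewrite /Defs.conv slab_intE; apply: eq_Rintegral => w _; rewrite /slab_cut.
  case: ifPn => [w01|]; last by rewrite mulr0.
  congr (_ * _); rewrite -time_to_stpoint to_stpoint_add to_stpoint_opp.
  case: ifPn => // zw; apply: G0.
  move: zw z01 w01; rewrite -!time_to_stpoint negb_and -!leNgt.
  rewrite /time !mxE => /orP[//|zw] /andP[z0 z1] /andP[w0 w1].
  lra.
rewrite ex.
- apply: eq_Rintegral => w _; rewrite {1 3}/slab_cut; case: ifPn => [w01|]; last by rewrite mul0r.
  congr (_ * _); rewrite -[RHS]Ggreen ?time_to_stpoint // slab_intE.
  apply: eq_Rintegral => y _; rewrite /slab_cut /= to_stpoint_add [st y + _]addrC.
  by case: ifP; rewrite ?mul0r.
- by move=> i w i0; exact: slab_cut_periodic.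
- by move=> i w i0 /=; rewrite to_stpoint_add to_stpoint_unit Lp.
- by move=> w /negPf w01; rewrite /slab_cut w01.
- by move=> w w01 /=; rewrite L0 // time_to_stpoint.
Qed.

End heat_solution.

(** * The renormalised equation *)

Section equation.
Variables (R : realType) (d : nat) (alpha kappa : R) (g f : jetfun R d).
Variables (ell : seq (tree d) -> R) (xi : stpoint R d -> R).
Hypothesis hell : renorm_character alpha kappa ell.
Variable Gs : seq (ptree d).
Hypothesis GsP : forall u, u \in Gs <-> contributing alpha kappa g f u.

Lemma Ups_tone Z : Ups g f tone Z = g Z.
Proof. by rewrite /Ups repr_tone /= iter_dir_mi0 mulr1. Qed.

Lemma symf_tone : symf (@tone d) = 1%N.
Proof. by rewrite /symf repr_tone psym_root. Qed.

Lemma tone_nonpos : treesX_nonpos alpha kappa (@tone d).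
Proof.
split; first by rewrite /treesX /= repr_tone /= !andbT; apply/eqP.
by rewrite /deg repr_tone /= add0r addr0 sdeg_mi0.
Qed.

(** The trees [1] and [Xi] give the two terms of the original equation. *)
Lemma expansion_split z Z : alpha <= 1 -> 0 < kappa ->
  \sum_(sigma \in treesX_nonpos alpha kappa)
     coeff ell xi sigma z / (symf sigma)%:R * Ups g f sigma Z
  = g Z + f Z * xi z
    + \sum_(sigma \in treesX_nonpos alpha kappa `\` [set tone; tXi])
        ell [:: sigma] / (symf sigma)%:R * Ups g f sigma Z.
Proof.
move=> a1 k0; pose cls (u : ptree d) : tree d := \pi_(tree d)%qT u.
pose C := [seq s <- undup [seq cls u | u <- Gs] | (s != tone) && (s != tXi)].
have clsT u : u \in Gs -> treesX_nonpos alpha kappa (cls u).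
  move=> /GsP[uT _ u0]; split; first by rewrite /treesX /= -(in_TX_iso (repr_iso _)).
  by rewrite /deg -(pdeg_iso _ _ (repr_iso _)).
have off sigma : treesX_nonpos alpha kappa sigma -> sigma != tone -> sigma != tXi ->
    sigma \notin C -> Ups g f sigma = fun=> 0.
  move=> sN s1 sX sC; apply: (Ups_eq0 GsP sN); apply: contra sC => sG.
  by rewrite mem_filter s1 sX mem_undup.
have toneX : (@tone d == tXi) = false.
  by apply/eqP => /(congr1 repr); rewrite repr_tone repr_tXi.
rewrite (@fsum_seq _ _ _ [:: tone, tXi & C]).
- rewrite !big_cons symf_tone symf_tXi Ups_tone Ups_tXi !invr1 !mulr1 addrA.
  have [_ l1 _ _] := hell.
  rewrite /coeff toneX eqxx l1 mul1r [xi z * _]mulrC; congr (_ + _).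
  rewrite (@fsum_seq _ _ _ C) ?filter_uniq ?undup_uniq //.
  + apply: eq_big_seq => sigma; rewrite mem_filter => /andP[/andP[_ /negPf sX] _].
    by rewrite sX.
  + move=> sigma; rewrite mem_filter => /andP[/andP[s1 sX]].
    rewrite mem_undup => /mapP[u uG e]; split; first by rewrite e; exact: clsT.
    by move=> [|] e'; [move: s1|move: sX]; rewrite e' eqxx.
  + move=> sigma [sN sNN] sC; rewrite (off sigma) ?mulr0 //.
    * by apply/eqP => e; apply: sNN; left.
    * by apply/eqP => e; apply: sNN; right.
- by rewrite /= !inE toneX /= !mem_filter !eqxx !andbF /= filter_uniq ?undup_uniq.
- move=> sigma; rewrite !inE => /or3P[/eqP ->|/eqP ->|]; first exact: tone_nonpos.
    exact: tXi_nonpos.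
  by rewrite mem_filter mem_undup => /andP[_ /mapP[u uG ->]]; exact: clsT.
- move=> sigma sN; rewrite !in_cons => /norP[s1 /norP[sX sC]].
  by rewrite (off sigma sN s1 sX sC) mulr0.
Qed.

End equation.

Lemma depends_upto_le (R : realType) d m n (F : jetfun R d) : (m <= n)%N ->
  depends_upto m F -> depends_upto n F.
Proof.
by move=> mn dF Z Z' ZZ'; apply: dF => a a0 am; apply: ZZ' => //; exact: leq_trans am mn.
Qed.

Lemma solves_heat_eq (R : realType) d (u h h' : stpoint R d -> R) :
  (forall z, slab z -> h z = h' z) -> solves_heat u h -> solves_heat u h'.
Proof.
move=> hh' uh eta es ep et; rewrite (uh eta es ep et).
by apply: eq_Rintegral => w /set_mem wD; rewrite hh'.
Qed.

Theorem theorem5p5 (R : realType) (d p q : nat) (alpha kappa : R)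
    (g f : jetfun R d) (chi : R -> R) (G : stpoint R d -> R)
    (xi : R -> stpoint R d -> R) (ell : seq (tree d) -> R) :
  (0 < d)%N -> (p < 2)%N -> (q < 2)%N ->
  0 < alpha <= 1 -> 0 < kappa ->
  jet_smooth g -> depends_upto q g ->
  jet_smooth f -> depends_upto p f ->
  subcritical alpha kappa g f ->
  cutoff chi -> green_kernel G ->
  (forall eps, 0 < eps <= 1 -> smooth_on setT (xi eps) /\ space_periodic (xi eps)) ->
  renorm_character alpha kappa ell ->
  forall eps : R, 0 < eps <= 1 ->
    let Pi := PiR g f ell chi G (xi eps) 0 in
    let F := force g f ell chi G (xi eps) 0 in
    [/\ finite_set [set tau | trees0 tau /\ Pi tau <> (fun _ _ => 0)],
        finite_set [set sigma | treesX_nonpos alpha kappa sigma /\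
          (fun z Z => coeff ell (xi eps) sigma z * Ups g f sigma Z)
            <> (fun _ _ => 0)],
        (forall (phi : stpoint R d -> R) (z : stpoint R d),
           smooth_on (@slab R d) phi -> space_periodic phi -> slab z ->
           \sum_(tau \in trees0) (symf tau)%:R^-1 * Pi tau phi z
           = \sum_(sigma \in treesX_nonpos alpha kappa)
               coeff ell (xi eps) sigma z / (symf sigma)%:R
               * Ups g f sigma (jet phi z)) &
        forall phi : stpoint R d -> R, coarse_solution G F phi ->
          solves_heat phi (fun z =>
            g (jet phi z) + f (jet phi z) * xi eps z
            + \sum_(sigma \in treesX_nonpos alpha kappa `\` [set tone; tXi])
                ell [:: sigma] / (symf sigma)%:R * Ups g f sigma (jet phi z))].

Proof.
move=> _ p2 q2 /andP[_ a1] k0 sg dg sf df sub _ green _ hell eps _ Pi F.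
have [r [eta gr]] := subcritical_gain a1 k0 sub.
have dg1 : depends_upto 1 g by apply: depends_upto_le dg; rewrite -ltnS.
have df1 : depends_upto 1 f by apply: depends_upto_le df; rewrite -ltnS.
have /finite_seqP[s sE] := finite_nonpos_trees gr dg1 df1.
have uGs : uniq (undup s) by exact: undup_uniq.
have GsP u : u \in undup s <-> contributing alpha kappa g f u.
  rewrite mem_undup; split=> [us|gu].
    have : [set` s] u by [].
    by rewrite -sE.
  suff : [set` s] u by [].
  by rewrite -sE.
have expansion phi z := PiR_expansion gr hell sg sf chi G (xi eps) uGs GsP phi z a1 k0.
split.
- exact: finite_PiR gr hell chi G (xi eps) _ uGs GsP.
- exact: finite_Ups GsP.
- by move=> phi z _ _ _; exact: expansion.
- move=> phi [_ _ Fint phiE].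
  apply: solves_heat_eq (conv_solves_heat green Fint phiE) => z _.
  by rewrite /F /force [LHS]expansion (expansion_split (xi eps) hell GsP).
Qed.
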